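(* Let $G$ be a $2$-Engel group of nilpotency class exactly $3$. Then $B(3,G)$ is not an Eilenberg–MacLane space of type $K(\pi,1)$ (for any group $\pi$).
   Context: With $[x,y]=x^{-1}y^{-1}xy$ and $[x,y,z]=[[x,y],z]$, a group $G$ is $2$-Engel if $[x,y,y]=1$ for all $x,y\in G$. A tuple $(x_0,\dots,x_k)\in G^{k+1}$ is called affinely nil-$2$ if there exist $y\in G$ and a subgroup $H\leq G$, nilpotent of class at most $2$, such that $x_i\in yH$ for all $i$. $E_\ast(3,G)$ is the simplicial set whose $k$-simplices are the affinely nil-$2$ tuples $(x_0,\dots,x_k)\in G^{k+1}$, with face maps $d_i$ omitting the $i$-th coordinate and degeneracy maps $s_i$ repeating the $i$-th coordinate; $E(3,G)$ is its geometric realization. The group $G$ acts freely on $E(3,G)$ by left translation, $g\cdot(x_0,\dots,x_k)=(gx_0,\dots,gx_k)$, and $B(3,G):=E(3,G)/G$ is the quotient (so $E(3,G)\to B(3,G)$ is a covering). *)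

(* Defs.v *)
From HB Require Import structures.
From Stdlib Require Import Relation_Operators Operators_Properties.
From mathcomp Require Import all_boot all_order all_algebra zify lra.
From mathcomp Require Import all_classical all_reals topology normedtype.

Set Implicit Arguments.
Unset Strict Implicit.
Unset Printing Implicit Defensive.

Import Order.TTheory GRing.Theory Num.Theory.
Import numFieldNormedType.Exports.

Local Open Scope classical_set_scope.
Local Open Scope ring_scope.
Local Open Scope quotient_scope.

Definition two_engel (G : groupType) : Prop :=
  forall x y : G, [~ x, y, y]%g = 1%g.

Definition is_subgroup (G : groupType) (H : set G) : Prop :=
  [/\ H 1%g, forall x y, H x -> H y -> H (x * y)%g & forall x, H x -> H x^-1%g].

(* [lcs H n] is the term usually written gamma_(n+1)(H). *)
Fixpoint lcs (G : groupType) (H : set G) (n : nat) : set G :=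
  if n is m.+1 then
    smallest (@is_subgroup G)
      [set z | exists x y, [/\ lcs H m x, H y & z = [~ x, y]%g]]
  else H.

Definition nilpotent_le (G : groupType) (c : nat) (H : set G) : Prop :=
  lcs H c = [set 1%g].

Definition nilpotency_class (G : groupType) (c : nat) (H : set G) : Prop :=
  nilpotent_le c H /\ forall k, nilpotent_le k H -> (c <= k)%N.

Definition equiv_gen (T : Type) (r : T -> T -> Prop) : rel T :=
  fun x y => `[< clos_refl_sym_trans T r x y >].

Lemma equiv_gen_refl (T : Type) (r : T -> T -> Prop) : reflexive (equiv_gen r).
Proof. by move=> x; apply/asboolP; exact: rst_refl. Qed.

Lemma equiv_gen_sym (T : Type) (r : T -> T -> Prop) : symmetric (equiv_gen r).
Proof. by move=> x y; apply: asbool_equiv_eq; split; exact: rst_sym. Qed.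

Lemma equiv_gen_trans (T : Type) (r : T -> T -> Prop) :
  transitive (equiv_gen r).
Proof.
by move=> y x z /asboolP xy /asboolP yz; apply/asboolP; exact: rst_trans yz.
Qed.

Canonical equiv_gen_equiv (T : Type) (r : T -> T -> Prop) :=
  EquivRel (equiv_gen r) (@equiv_gen_refl T r) (@equiv_gen_sym T r)
    (@equiv_gen_trans T r).

Definition quotient_by (T : choiceType) (r : T -> T -> Prop) :=
  {eq_quot equiv_gen r}.

Definition quotient_space (T : topologicalType) (r : T -> T -> Prop) :
  topologicalType := quotient_topology (quotient_by r).

Definition class_of (T : topologicalType) (r : T -> T -> Prop) (x : T) :
  quotient_space r := \pi_(quotient_by r) x.

Definition rep_of (T : topologicalType) (r : T -> T -> Prop)
  (p : quotient_space r) : T := repr (p : quotient_by r).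

Lemma class_ofP (T : topologicalType) (r : T -> T -> Prop) (x y : T) :
  class_of r x = class_of r y <-> clos_refl_sym_trans T r x y.
Proof.
have e := @eqmodP T (equiv_gen_equiv r) x y.
by split=> [/e/asboolP|xy]; last by apply/e/asboolP.
Qed.

Lemma rep_ofK (T : topologicalType) (r : T -> T -> Prop)
  (p : quotient_space r) : class_of r (rep_of p) = p.
Proof. exact: (@reprK _ (quotient_by r)). Qed.

(* The monotone surjection [n+1] -> [n] taking the value i twice. *)
Fact ord_codegen_subproof n (i : 'I_n.+1) (j : 'I_n.+2) : (unbump i j < n.+1)%N.
Proof. by rewrite /unbump; have := ltn_ord i; have := ltn_ord j; lia. Qed.

Definition ord_codegen n (i : 'I_n.+1) (j : 'I_n.+2) : 'I_n.+1 :=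
  Ordinal (ord_codegen_subproof i j).

Definition ordW n (i : 'I_n) : 'I_n.+1 := widen_ord (leqnSn n) i.
Definition ordSn n (i : 'I_n) : 'I_n.+1 := lift ord0 i.

(* The laws are the simplicial identities, each indexed so that both sides
   typecheck without index subtraction: [ordW i] and [ordSn i] have values
   i and i.+1. *)
Record simplicialSet := SimplicialSet {
  simplices :> nat -> choiceType;
  face : forall n, 'I_n.+2 -> simplices n.+1 -> simplices n;
  degen : forall n, 'I_n.+1 -> simplices n -> simplices n.+1;
  face_face : forall n (i j : 'I_n.+2) (x : simplices n.+2), (i <= j)%N ->
    face i (face (ordSn j) x) = face j (face (ordW i) x);
  degen_degen : forall n (i j : 'I_n.+1) (x : simplices n), (i <= j)%N ->
    degen (ordSn j) (degen i x) = degen (ordW i) (degen j x);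
  face_degen_lt : forall n (i : 'I_n.+2) (j : 'I_n.+1) (x : simplices n.+1),
    (i <= j)%N -> face (ordW i) (degen (ordSn j) x) = degen j (face i x);
  face_degen_eq : forall n (j : 'I_n.+1) (x : simplices n),
    face (ordW j) (degen j x) = x;
  face_degen_eqS : forall n (j : 'I_n.+1) (x : simplices n),
    face (ordSn j) (degen j x) = x;
  face_degen_gt : forall n (i : 'I_n.+2) (j : 'I_n.+1) (x : simplices n.+1),
    (j < i)%N -> face (ordSn i) (degen (ordW j) x) = degen j (face i x)
}.

Definition std_simplex (R : realType) (n : nat) : set 'rV[R]_n.+1 :=
  [set t | (forall i, 0 <= t ord0 i) /\ \sum_i t ord0 i = 1].
Arguments std_simplex : clear implicits.

Fact push_subproof (R : realType) m n (f : 'I_m.+1 -> 'I_n.+1)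
    (t : std_simplex R m) :
  (\row_j \sum_(i | f i == j) val t ord0 i) \in std_simplex R n.
Proof.
apply/mem_set; have [t0 t1] := set_mem (valP t).
split=> [j|]; first by rewrite mxE; apply: sumr_ge0.
under eq_bigr do rewrite mxE.
by rewrite -t1 (partition_big f xpredT).
Qed.

(* The affine map of simplices induced by a map of vertices. *)
Definition push (R : realType) m n (f : 'I_m.+1 -> 'I_n.+1)
    (t : std_simplex R m) : std_simplex R n := 
  exist (fun u => u \in std_simplex R n) _ (push_subproof f t).

Section Realization.
Context (R : realType) (X : simplicialSet).

(* The disjoint union of one copy of the standard n-simplex for each
   n-simplex of X, with the coproduct topology. *)
Definition cells : topologicalType :=
  {s : {n & X n} & std_simplex R (tag s)}.

Definition cell n (x : X n) (t : std_simplex R n) : cells :=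
  existT (fun s : {n & X n} => std_simplex R (tag s) : topologicalType)
    (existT (fun n => X n) n x) t.

Inductive glue : cells -> cells -> Prop :=
| glue_face n (i : 'I_n.+2) (x : X n.+1) (t : std_simplex R n) :
    glue (cell (face i x) t) (cell x (push (lift i) t))
| glue_degen n (i : 'I_n.+1) (x : X n) (t : std_simplex R n.+1) :
    glue (cell (degen i x) t) (cell x (push (ord_codegen i) t)).

Definition realization : topologicalType := quotient_space glue.

Definition rpoint n (x : X n) (t : std_simplex R n) : realization :=
  class_of glue (cell x t).

End Realization.

Record simplicialMap (X Y : simplicialSet) := SimplicialMap {
  smap : forall n, X n -> Y n;
  smap_face : forall n (i : 'I_n.+2) (x : X n.+1),
    smap (face i x) = face i (smap x);
  smap_degen : forall n (i : 'I_n.+1) (x : X n),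
    smap (degen i x) = degen i (smap x)
}.

Section RealizationMap.
Context (R : realType) (X Y : simplicialSet) (f : simplicialMap X Y).

Definition cell_map (c : cells R X) : cells R Y :=
  cell (smap f (tagged (tag c))) (tagged c).

Definition realization_map (p : realization R X) : realization R Y :=
  class_of (@glue R Y) (cell_map (rep_of p)).

Lemma realization_mapE n (x : X n) (t : std_simplex R n) :
  realization_map (rpoint x t) = rpoint (smap f x) t.
Proof.
apply/class_ofP; rewrite -[cell (smap f x) t]/(cell_map (cell x t)).
have /class_ofP : class_of (@glue R X) (rep_of (rpoint x t)) =
  class_of (@glue R X) (cell x t) by rewrite rep_ofK.
elim=> [_ _ [m i z u|m i z u]|c|c d _|c d e _ + _].
- by rewrite /cell_map /= smap_face; apply: rst_step; exact: glue_face.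
- by rewrite /cell_map /= smap_degen; apply: rst_step; exact: glue_degen.
- exact: rst_refl.
- exact: rst_sym.
- exact: rst_trans.
Qed.

End RealizationMap.

Section E3.
Context (G : groupType).

Definition affinely_nil2 k : set {ffun 'I_k.+1 -> G} :=
  [set x | exists (y : G) (H : set G), [/\ is_subgroup H, nilpotent_le 2 H &
     forall i, exists2 h, H h & x i = (y * h)%g]].
Arguments affinely_nil2 : clear implicits.

Fact affinely_nil2_reindex k l (f : 'I_l.+1 -> 'I_k.+1)
    (x : affinely_nil2 k) :
  [ffun i => val x (f i)] \in affinely_nil2 l.
Proof.
apply/mem_set; have [y [H [sH nH Hx]]] := set_mem (valP x).
by exists y, H; split=> // i; rewrite ffunE.
Qed.

Definition reindex k l (f : 'I_l.+1 -> 'I_k.+1) (x : affinely_nil2 k) :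
  affinely_nil2 l := 
  exist (fun u => u \in affinely_nil2 l) _ (affinely_nil2_reindex f x).

Lemma reindex_comp k l m (f : 'I_l.+1 -> 'I_k.+1) (g : 'I_m.+1 -> 'I_l.+1)
    (x : affinely_nil2 k) : reindex g (reindex f x) = reindex (f \o g) x.
Proof. by apply/val_inj/ffunP => i /=; rewrite !ffunE. Qed.

Lemma eq_reindex k l (f g : 'I_l.+1 -> 'I_k.+1) (x : affinely_nil2 k) :
  f =1 g -> reindex f x = reindex g x.
Proof. by move=> fg; apply/val_inj/ffunP => i /=; rewrite !ffunE fg. Qed.

Lemma reindex_id k (f : 'I_k.+1 -> 'I_k.+1) (x : affinely_nil2 k) :
  f =1 id -> reindex f x = x.
Proof. by move=> fg; apply/val_inj/ffunP => i /=; rewrite !ffunE fg. Qed.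

Definition E3_face k (i : 'I_k.+2) : affinely_nil2 k.+1 -> affinely_nil2 k :=
  reindex (lift i).

Definition E3_degen k (i : 'I_k.+1) : affinely_nil2 k -> affinely_nil2 k.+1 :=
  reindex (ord_codegen i).

Ltac ord_lia :=
  intros; rewrite /E3_face /E3_degen ?reindex_comp;
  first [apply: eq_reindex | apply: reindex_id] => ?; apply/val_inj;
  rewrite /= ?/bump ?/unbump ?/bump /=; lia.

Fact E3_face_face k (i j : 'I_k.+2) x : (i <= j)%N ->
  E3_face i (E3_face (ordSn j) x) = E3_face j (E3_face (ordW i) x).
Proof. ord_lia. Qed.

Fact E3_degen_degen k (i j : 'I_k.+1) x : (i <= j)%N ->
  E3_degen (ordSn j) (E3_degen i x) = E3_degen (ordW i) (E3_degen j x).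
Proof. ord_lia. Qed.

Fact E3_face_degen_lt k (i : 'I_k.+2) (j : 'I_k.+1) x : (i <= j)%N ->
  E3_face (ordW i) (E3_degen (ordSn j) x) = E3_degen j (E3_face i x).
Proof. ord_lia. Qed.

Fact E3_face_degen_eq k (j : 'I_k.+1) x : E3_face (ordW j) (E3_degen j x) = x.
Proof. ord_lia. Qed.

Fact E3_face_degen_eqS k (j : 'I_k.+1) x : E3_face (ordSn j) (E3_degen j x) = x.
Proof. ord_lia. Qed.

Fact E3_face_degen_gt k (i : 'I_k.+2) (j : 'I_k.+1) x : (j < i)%N ->
  E3_face (ordSn i) (E3_degen (ordW j) x) = E3_degen j (E3_face i x).
Proof. ord_lia. Qed.

Definition E3_sset : simplicialSet :=
  @SimplicialSet (fun k => affinely_nil2 k : choiceType) E3_face E3_degen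
    E3_face_face E3_degen_degen E3_face_degen_lt E3_face_degen_eq
    E3_face_degen_eqS E3_face_degen_gt.

Fact translate_subproof (g : G) k (x : affinely_nil2 k) :
  [ffun i => (g * val x i)%g] \in affinely_nil2 k.
Proof.
apply/mem_set; have [y [H [sH nH Hx]]] := set_mem (valP x).
exists (g * y)%g, H; split=> // i; have [h Hh xh] := Hx i.
by exists h => //; rewrite ffunE xh mulgA.
Qed.

Definition translate (g : G) k (x : affinely_nil2 k) : affinely_nil2 k :=
  exist (fun u => u \in affinely_nil2 k) _ (translate_subproof g x).

Fact translate_reindex (g : G) k l (f : 'I_l.+1 -> 'I_k.+1)
    (x : affinely_nil2 k) :
  translate g (reindex f x) = reindex f (translate g x).
Proof. by apply/val_inj/ffunP => i /=; rewrite !ffunE. Qed.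

Definition translate_smap (g : G) : simplicialMap E3_sset E3_sset :=
  @SimplicialMap E3_sset E3_sset (translate g)
    (fun n i => translate_reindex g (lift i))
    (fun n i => translate_reindex g (ord_codegen i)).

Context (R : realType).

Definition E3 : topologicalType := realization R E3_sset.

Definition E3_act (g : G) : E3 -> E3 := realization_map (translate_smap g).

Definition E3_orbit (p q : E3) : Prop := exists g : G, q = E3_act g p.

Lemma E3_act1 (p : E3) : E3_act 1%g p = p.
Proof.
rewrite -(rep_ofK p); case: (rep_of p) => -[n x] t.
rewrite [LHS](realization_mapE (translate_smap 1%g) x t) /=.
suff -> : translate 1%g x = x by [].
by apply/val_inj/ffunP => i /=; rewrite ffunE mul1g.
Qed.

Lemma E3_actM (g h : G) (p : E3) : E3_act (g * h)%g p = E3_act g (E3_act h p).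
Proof.
rewrite -(rep_ofK p); case: (rep_of p) => -[n x] t.
rewrite [LHS](realization_mapE (translate_smap (g * h)%g) x t).
rewrite -[class_of _ _]/(rpoint (x : E3_sset n) t).
rewrite /E3_act !realization_mapE /=.
suff -> : translate (g * h)%g x = translate g (translate h x) by [].
by apply/val_inj/ffunP => i /=; rewrite !ffunE mulgA.
Qed.

(* By the two lemmas above [E3_orbit] is already an equivalence relation, so
   B3 is the orbit space. *)
Definition B3 : topologicalType := quotient_space E3_orbit.

End E3.
Arguments affinely_nil2 : clear implicits.

Section Homotopy.
Context (R : realType).

Definition cube n : set 'rV[R]_n :=
  [set t | forall i, 0 <= t ord0 i <= 1].
Arguments cube : clear implicits.

Definition cube_boundary n : set 'rV[R]_n :=
  [set t | cube n t /\ exists i, t ord0 i = 0 \/ t ord0 i = 1].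
Arguments cube_boundary : clear implicits.

Context (X : topologicalType).

(* Only the values on the cube matter; two loops agreeing there are
   homotopic in the sense of [homotopic] below. *)
Record nloop n (x0 : X) := NLoop {
  nloop_fun :> 'rV[R]_n -> X;
  nloop_cts : {within cube n, continuous nloop_fun};
  nloop_boundary : forall t, cube_boundary n t -> nloop_fun t = x0
}.
Arguments nloop_cts {n x0}.

Definition homotopic n (x0 : X) (f g : nloop n x0) : Prop :=
  exists H : 'rV[R]_n * R -> X,
    [/\ {within cube n `*` `[0, 1], continuous H},
        forall t, cube n t -> H (t, 0) = f t,
        forall t, cube n t -> H (t, 1) = g t &
        forall t s, cube_boundary n t -> 0 <= s <= 1 -> H (t, s) = x0].

(* [homotopic] is already an equivalence relation, so the closure taken by
   [quotient_by] adds nothing. *)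
Definition homotopy_group n (x0 : X) :=
  @quotient_by {classic nloop n x0} (@homotopic n x0).

Definition hclass n (x0 : X) (f : nloop n x0) : homotopy_group n x0 :=
  \pi_(homotopy_group n x0) (f : {classic nloop n x0}).

Definition set_coord0 n (t : 'rV[R]_n.+1) (s : R) : 'rV[R]_n.+1 :=
  \row_j (if j == ord0 then s else t ord0 j).

Definition concat_fun n (f g : 'rV[R]_n.+1 -> X) (t : 'rV[R]_n.+1) : X :=
  if t ord0 ord0 <= 2^-1 then f (set_coord0 t (2 * t ord0 ord0))
  else g (set_coord0 t (2 * t ord0 ord0 - 1)).

Lemma coord0_cts n : continuous (fun t : 'rV[R]_n.+1 => t ord0 ord0).
Proof. exact: coord_continuous. Qed.

Lemma set_coord0_cts n (a b : R) :
  continuous (fun t : 'rV[R]_n.+1 => set_coord0 t (a * t ord0 ord0 + b)).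
Proof.
move=> t A /= [P /= Pnbhs PA].
suff : \forall s \near t, forall i j,
    P i j (set_coord0 s (a * s ord0 ord0 + b) i j).
  by apply: filterS => s; exact: PA.
apply: (@filter_forall _ _ (fun i s => forall j,
  P i j (set_coord0 s (a * s ord0 ord0 + b) i j)) (nbhs t)) => i.
apply: (@filter_forall _ _ (fun j s =>
  P i j (set_coord0 s (a * s ord0 ord0 + b) i j)) (nbhs t)) => j.
have := Pnbhs i j; rewrite mxE; case: ifPn => [/eqP j0|j0] nP.
  have : {for t, continuous (fun s : 'rV[R]_n.+1 => a * s ord0 ord0 + b)}.
    apply: (@continuous_comp _ _ _ (fun s : 'rV[R]_n.+1 => s ord0 ord0)
      (fun x => a * x + b)); first exact: coord0_cts.
    apply: (@continuousD _ R^o R^o (fun x => a * x) (fun=> b)).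
      exact: mulrl_continuous.
    exact: cvg_cst.
  move=> /(_ _ nP) fP; apply: (@filterS _ (nbhs t) _ _ _ _ fP) => s /=.
  by rewrite mxE j0 eqxx.
have : {for t, continuous (fun s : 'rV[R]_n.+1 => s ord0 j)}.
  exact: coord_continuous.
move=> /(_ _ nP) fP; apply: (@filterS _ (nbhs t) _ _ _ _ fP) => s /=.
by rewrite mxE (negPf j0).
Qed.

Lemma comp_within (T : topologicalType) (A B : set T) (f : T -> X) (h : T -> T) :
  continuous h -> (forall t, A t -> B (h t)) ->
  {within B, continuous f} -> {within A, continuous (f \o h)}.
Proof.
move=> ch AB /subspace_continuousP cf; apply/subspace_continuousP => t At.
apply: cvg_trans (cf _ (AB _ At)).
move=> U /= /ch; rewrite /= !nbhs_simpl/= /within/= => tU.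
by apply: filterS tU => s hs As; apply: hs; exact: AB.
Qed.

Lemma eq_within (T : topologicalType) (A : set T) (f g : T -> X) :
  (forall t, A t -> f t = g t) ->
  {within A, continuous f} -> {within A, continuous g}.
Proof.
by move=> fg; apply: subspace_eq_continuous => t /set_mem; exact: fg.
Qed.

Lemma closed_cube n : closed (cube n).
Proof.
rewrite (_ : cube n = \bigcap_(i in [set: 'I_n])
    (fun t : 'rV[R]_n => t ord0 i) @^-1` `[0, 1]).
  apply: closed_bigI => i _; apply: preimage_closed; last exact: itv_closed.
  by move=> t _; exact: coord_continuous.
apply/seteqP; split=> t /= ct i; first by rewrite /= in_itv/=.
by have := ct i Logic.I; rewrite /= in_itv.
Qed.

Fact concat_cts n (x0 : X) (f g : nloop n.+1 x0) :
  {within cube n.+1, continuous (concat_fun f g)}.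
Proof.
pose lo : set 'rV[R]_n.+1 := [set t | t ord0 ord0 <= 2^-1].
pose hi : set 'rV[R]_n.+1 := [set t | 2^-1 <= t ord0 ord0].
rewrite (_ : cube n.+1 = (cube n.+1 `&` lo) `|` (cube n.+1 `&` hi)); last first.
  rewrite -setIUr; apply/esym/setIidPl => t _ /=.
  by case: (leP (t ord0 ord0) 2^-1) => [|/ltW]; [left|right].
apply: withinU_continuous.
- apply: closedI; first exact: closed_cube.
  apply: (@preimage_closed _ R (fun t : 'rV[R]_n.+1 => t ord0 ord0)
    [set x | x <= 2^-1]); last exact: closed_le.
  by move=> t _; exact: coord0_cts.
- apply: closedI; first exact: closed_cube.
  apply: (@preimage_closed _ R (fun t : 'rV[R]_n.+1 => t ord0 ord0)
    [set x | 2^-1 <= x]); last exact: closed_ge.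
  by move=> t _; exact: coord0_cts.
- apply: (@eq_within _ _
    (f \o fun t => set_coord0 t (2 * t ord0 ord0 + 0))).
    move=> t [_ /= t2].
    by rewrite /concat_fun t2 addr0.
  refine (@comp_within _ _ _ _ (fun t => set_coord0 t (2 * t ord0 ord0 + 0))
    _ _ (nloop_cts f)); first exact: set_coord0_cts.
  move=> t [ct]; rewrite /lo /= => t2 i; rewrite mxE; case: eqP => // _.
  by case/andP: (ct ord0) => ? ?; apply/andP; split; lra.
- apply: (@eq_within _ _
    (g \o fun t => set_coord0 t (2 * t ord0 ord0 - 1))).
    move=> t [ct /= t2]; rewrite /concat_fun.
    case: ifPn => // t2'.
    have -> : t ord0 ord0 = 2^-1 by apply/eqP; rewrite eq_le t2 t2'.
    rewrite !nloop_boundary//; split.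
    + by move=> i; rewrite mxE; case: eqP => // _; apply/andP; split; lra.
    + by exists ord0; right; rewrite mxE eqxx; lra.
    + by move=> i; rewrite mxE; case: eqP => // _; apply/andP; split; lra.
    + by exists ord0; left; rewrite mxE eqxx; lra.
  refine (@comp_within _ _ _ _ (fun t => set_coord0 t (2 * t ord0 ord0 - 1))
    _ _ (nloop_cts g)); first exact: set_coord0_cts.
  move=> t [ct]; rewrite /hi /= => t2 i; rewrite mxE; case: eqP => // _.
  by case/andP: (ct ord0) => ? ?; apply/andP; split; lra.
Qed.

Fact concat_boundary n (x0 : X) (f g : nloop n.+1 x0) t :
  cube_boundary n.+1 t -> concat_fun f g t = x0.
Proof.
move=> [ct [i it]]; rewrite /concat_fun; case/andP: (ct ord0) => ? ?.
case: ifPn => [t2|]; last rewrite -ltNge => t2; apply: nloop_boundary; split.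
- by move=> j; rewrite mxE; case: eqP => // _; apply/andP; split; lra.
- exists i; rewrite mxE; case: eqP => [i0|_]//; left.
  by move: it; rewrite i0 => -[->|it]; lra.
- by move=> j; rewrite mxE; case: eqP => // _; apply/andP; split; lra.
- exists i; rewrite mxE; case: eqP => [i0|_]//; right.
  by move: it; rewrite i0 => -[it|->]; lra.
Qed.

Definition concat n (x0 : X) (f g : nloop n.+1 x0) : nloop n.+1 x0 :=
  NLoop (@concat_cts n x0 f g) (@concat_boundary n x0 f g).

(* The product of pi_1 is the class of the concatenation of loops. *)
Definition pi1_isomorphic (x0 : X) (P : groupType) : Prop :=
  exists phi : homotopy_group 1 x0 -> P, bijective phi /\
    forall f g : nloop 1 x0,
      phi (hclass (concat f g)) = (phi (hclass f) * phi (hclass g))%g.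

Definition path_connected : Prop :=
  inhabited X /\
  forall x y : X, exists gamma : R -> X,
    [/\ {within `[0, 1], continuous gamma}, gamma 0 = x & gamma 1 = y].

Definition eilenberg_maclane1 (P : groupType) : Prop :=
  path_connected /\
  forall x0 : X, pi1_isomorphic x0 P /\
    forall n, (2 <= n)%N -> forall a b : homotopy_group n x0, a = b.

End Homotopy.

Arguments cube : clear implicits.
Arguments cube_boundary : clear implicits.
Arguments nloop_cts {R X n x0}.
Arguments eilenberg_maclane1 : clear implicits.

(* Main.v *)
Require Import Defs.
From HB Require Import structures.
From Stdlib Require Import Relation_Operators.
From mathcomp Require Import all_boot all_order all_algebra zify lra.
From mathcomp Require Import interval_inference all_classical all_reals.
From mathcomp Require Import topology normedtype.

Set Implicit Arguments.
Unset Strict Implicit.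
Unset Printing Implicit Defensive.

Import Order.TTheory GRing.Theory Num.Theory.
Import numFieldNormedType.Exports.

Local Open Scope classical_set_scope.
Local Open Scope ring_scope.

(** Put omega(x,y,z) = [x,y,z].  In a 2-Engel group of class 3 it is an alternating
    trilinear form with central values, it vanishes on (x0^-1 x1, x0^-1 x2, x0^-1 x3)
    for every affinely nil-2 tuple, and omega(a,b,c) <> 1 for some a, b, c.  Two
    elements generate a subgroup of class at most 2, so every triple is affinely
    nil-2 and the boundary of the tetrahedron 1, a, b, c is a sphere in E(3,G).  Its
    image in B(3,G) is not nullhomotopic, so pi_2(B(3,G)) <> 0.

    A point of E(3,G) is a step function [0,1] -> G.  For a continuous distribution
    function F on [0,1], the points for which one value g has F-measure > 1/2 form
    an open set on which the label g is locally constant and equivariant.  These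
    sets cover, so two distribution functions yield locally constant transition
    elements on B(3,G).  A nullhomotopy subdivided finely enough gives a G-valued
    1-cocycle on the grid of a cube, hence a labelling of the grid by G whose
    labels on each small cube form an affinely nil-2 set.  As omega(x1-x0, x2-x0,
    x3-x0) is the coboundary of omega, the sum of omega over the labelled boundary
    of the cube vanishes; on the face carrying the sphere a Sperner count shows
    that this sum is omega(a,b,c). *)

(** * Central triple commutators *)

Section Abel.
Context (V : zmodType).

Inductive zexp := ZVar of nat | ZZero | ZAdd of zexp & zexp | ZOpp of zexp.

Fixpoint zeval (env : seq V) (e : zexp) : V :=
  match e with
  | ZVar i => env`_i
  | ZZero => 0
  | ZAdd e1 e2 => zeval env e1 + zeval env e2
  | ZOpp e1 => - zeval env e1
  end.

Fixpoint zflat (e : zexp) : seq nat * seq nat :=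
  match e with
  | ZVar i => ([:: i], [::])
  | ZZero => ([::], [::])
  | ZAdd e1 e2 => ((zflat e1).1 ++ (zflat e2).1, (zflat e1).2 ++ (zflat e2).2)
  | ZOpp e1 => ((zflat e1).2, (zflat e1).1)
  end.

Lemma zflatE env e : zeval env e =
  \sum_(i <- (zflat e).1) env`_i - \sum_(i <- (zflat e).2) env`_i.
Proof.
elim: e => [i||e1 IH1 e2 IH2|e IH] /=.
- by rewrite big_seq1 big_nil subr0.
- by rewrite big_nil subr0.
- by rewrite IH1 IH2 !big_cat/= opprD addrACA.
- by rewrite IH opprB.
Qed.

(** Negative atoms are moved to the other side, so that an identity reduces to a permutation of two
    lists of indices, which is decided by computation. *)
Lemma zexp_eq env e1 e2 :
  perm_eq ((zflat e1).1 ++ (zflat e2).2) ((zflat e2).1 ++ (zflat e1).2) ->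
  zeval env e1 = zeval env e2.
Proof.
move=> p; rewrite !zflatE; apply/eqP.
rewrite subr_eq addrAC eq_sym subr_eq -!big_cat; apply/eqP.
by rewrite [RHS](perm_big _ p).
Qed.

End Abel.

(** The dummy matches on [Set] let [unify] run while a term is being computed; when it fails, the
    search goes on in the tail. *)
Ltac zmem t l :=
  lazymatch l with
  | [::] => constr:(false)
  | ?h :: ?l' => match constr:(Set) with
    | _ => let _ := match constr:(Set) with _ => unify h t end in constr:(true)
    | _ => zmem t l'
    end
  end.

Ltac zatoms t l :=
  lazymatch t with
  | (?a + ?b)%R => let l1 := zatoms a l in zatoms b l1
  | (- ?a)%R => zatoms a l
  | 0%R => l
  | _ => lazymatch zmem t l with true => l | false => constr:(t :: l) end
  end.

Ltac zindex t l :=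
  lazymatch l with
  | ?h :: ?l' => match constr:(Set) with
    | _ => let _ := match constr:(Set) with _ => unify h t end in constr:(0%N)
    | _ => let n := zindex t l' in constr:(n.+1)
    end
  end.

Ltac zreify t l :=
  lazymatch t with
  | (?a + ?b)%R =>
      let ea := zreify a l in let eb := zreify b l in constr:(ZAdd ea eb)
  | (- ?a)%R => let ea := zreify a l in constr:(ZOpp ea)
  | 0%R => constr:(ZZero)
  | _ => let n := zindex t l in constr:(ZVar n)
  end.

Ltac abel :=
  lazymatch goal with
  | |- @eq ?V ?a ?b =>
      let l := zatoms a (@nil V) in let l := zatoms b l in
      let ea := zreify a l in let eb := zreify b l in
      exact: (@zexp_eq _ l ea eb isT)
  end.

(** * Alternating trilinear forms on a group *)

Section Alternating3.
Context (G : groupType) (A : zmodType).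

(** Vanishing on repeated arguments is required instead of antisymmetry, which is weaker when [A]
    has 2-torsion. *)
Record alternating3 (om : G -> G -> G -> A) := Alternating3 {
  alt3Ml : forall x x' y z, om (x * x')%g y z = om x y z + om x' y z;
  alt3Mm : forall x y y' z, om x (y * y')%g z = om x y z + om x y' z;
  alt3Mr : forall x y z z', om x y (z * z')%g = om x y z + om x y z';
  alt3_xxy : forall x y, om x x y = 0;
  alt3_xyx : forall x y, om x y x = 0;
  alt3_xyy : forall x y, om x y y = 0
}.

Variable om : G -> G -> G -> A.
Hypothesis altom : alternating3 om.

Lemma alt3_1l y z : om 1%g y z = 0.
Proof. by apply: (addIr (om 1%g y z)); rewrite -alt3Ml// mulg1 add0r. Qed.

Lemma alt3_1m x z : om x 1%g z = 0.
Proof. by apply: (addIr (om x 1%g z)); rewrite -alt3Mm// mulg1 add0r. Qed.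

Lemma alt3_1r x y : om x y 1%g = 0.
Proof. by apply: (addIr (om x y 1%g)); rewrite -alt3Mr// mulg1 add0r. Qed.

Lemma alt3Vl x y z : om x^-1%g y z = - om x y z.
Proof. by apply: (addIr (om x y z)); rewrite -alt3Ml// mulVg alt3_1l addNr. Qed.

Lemma alt3Vm x y z : om x y^-1%g z = - om x y z.
Proof. by apply: (addIr (om x y z)); rewrite -alt3Mm// mulVg alt3_1m addNr. Qed.

Lemma alt3Vr x y z : om x y z^-1%g = - om x y z.
Proof. by apply: (addIr (om x y z)); rewrite -alt3Mr// mulVg alt3_1r addNr. Qed.

(** Polarisation: expand the vanishing of the form on [(y * x, y * x, z)]. *)
Lemma alt3C12 x y z : om y x z = - om x y z.
Proof.
apply/eqP; rewrite -addr_eq0; apply/eqP.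
have := alt3_xxy altom (y * x)%g z.
by rewrite alt3Ml// !alt3Mm// !alt3_xxy// add0r addr0.
Qed.

Lemma alt3C23 x y z : om x z y = - om x y z.
Proof.
apply/eqP; rewrite -addr_eq0; apply/eqP.
have := alt3_xyy altom x (z * y)%g.
by rewrite alt3Mm// !alt3Mr// !alt3_xyy// add0r addr0.
Qed.

(** Of the eight terms of the expansion, those containing [x0] twice vanish. So where the left side
    is zero, [om] is the coboundary of [om x0], that is, a sum over the three edges of the
    triangle. *)
Lemma alt3_affine x0 x y z :
  om (x0^-1 * x)%g (x0^-1 * y)%g (x0^-1 * z)%g =
  om x y z - (om x0 x y + om x0 y z + om x0 z x).
Proof.
rewrite !(alt3Ml altom, alt3Mm altom, alt3Mr altom).
rewrite !(alt3Vl, alt3Vm, alt3Vr).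
rewrite !(alt3_xxy altom, alt3_xyx altom, alt3_xyy altom).
rewrite (alt3C23 x x0 y) (alt3C12 x0 x y) (alt3C12 x0 x z) (alt3C23 x0 z x).
by abel.
Qed.

End Alternating3.

(** * The center as an abelian group *)

Section Center.
Context (G : groupType).

Definition is_central (z : G) : bool := `[< forall g, commute z g >].

Lemma is_centralP (z : G) : reflect (forall g, commute z g) (is_central z).
Proof. exact: asboolP. Qed.

Record center := Center { center_val :> G; _ : is_central center_val }.

HB.instance Definition _ := [isSub for center_val].
HB.instance Definition _ := [Choice of center by <:].

Lemma is_central1 : is_central (1 : G)%g.
Proof. by apply/is_centralP => g; exact/commute_sym/commute1. Qed.

Lemma is_centralM (x y : G) :
  is_central x -> is_central y -> is_central (x * y)%g.
Proof.
move=> /is_centralP cx /is_centralP cy; apply/is_centralP => g.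
by apply/commute_sym/commuteM; apply/commute_sym.
Qed.

Lemma is_centralV (x : G) : is_central x -> is_central x^-1%g.
Proof.
move=> /is_centralP cx; apply/is_centralP => g.
by apply/commute_sym/commuteV; apply/commute_sym.
Qed.

Definition center_add (x y : center) :=
  Center (is_centralM (valP x) (valP y)).
Definition center_opp (x : center) := Center (is_centralV (valP x)).
Definition center_zero := Center is_central1.

Fact center_addA : associative center_add.
Proof. by move=> x y z; apply: val_inj; rewrite /= mulgA. Qed.

Fact center_addC : commutative center_add.
Proof. by move=> x y; apply: val_inj; exact: (is_centralP _ (valP x)). Qed.

Fact center_add0 : left_id center_zero center_add.
Proof. by move=> x; apply: val_inj; rewrite /= mul1g. Qed.

Fact center_addN : left_inverse center_zero center_opp center_add.
Proof. by move=> x; apply: val_inj; rewrite /= mulVg. Qed.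

HB.instance Definition _ :=
  GRing.isZmodule.Build center center_addA center_addC center_add0 center_addN.

End Center.

(** * Generated subgroups and class at most 2 *)

Section Subgroups.
Context (G : groupType).

Lemma generated_sub (S C : set G) :
  is_subgroup C -> S `<=` C -> smallest (@is_subgroup G) S `<=` C.
Proof. by move=> sC SC z; apply. Qed.

Lemma sub_generated (S : set G) : S `<=` smallest (@is_subgroup G) S.
Proof. by move=> z Sz C [_]; apply. Qed.

Lemma generated_subgroup (S : set G) :
  is_subgroup (smallest (@is_subgroup G) S).
Proof.
split=> [C [[]]//|x y Sx Sy C CS|x Sx C CS].
  by have [[_ CM _] _] := CS; apply: CM; [exact: Sx|exact: Sy].
by have [[_ _ CV] _] := CS; apply: CV; exact: Sx.
Qed.

Lemma commg_lcsS (H : set G) n x y :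
  lcs H n x -> H y -> lcs H n.+1 [~ x, y]%g.
Proof. by move=> Hx Hy; apply: sub_generated; exists x, y. Qed.

Lemma nilpotent_le2 (H : set G) : is_subgroup H ->
  nilpotent_le 2 H <->
  forall x y z, H x -> H y -> H z -> [~ x, y, z]%g = 1%g.
Proof.
move=> sH; split=> [nH x y z Hx Hy Hz|comm3].
  by have : lcs H 2 [~ x, y, z]%g;
    [do 2 apply: commg_lcsS => //|rewrite nH].
apply/seteqP; split; last by move=> _ ->; case: (@generated_subgroup
  [set z | exists x y, [/\ lcs H 1 x, H y & z = [~ x, y]%g]]).
apply: generated_sub => [|_ [x [y [Hx Hy ->]]]].
  split=> // [x y -> ->|x ->]; first by rewrite /= mulg1.
  by rewrite /= invg1.
(* The centralizer of [H] is a subgroup, so it contains [lcs H 1] as soon as it contains the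
   commutators generating it. *)
apply/eqP/commgP; suff : lcs H 1 `<=` [set u | forall y, H y -> commute u y].
  by move/(_ x Hx); apply.
apply: generated_sub => [|_ [u [v [Hu Hv ->]]] w Hw /=].
  split=> /= [w _|u v cu cv w Hw|u cu w Hw].
  - exact/commute_sym/commute1.
  - by apply/commute_sym/commuteM; apply/commute_sym; auto.
  - by apply/commute_sym/commuteV; apply/commute_sym; auto.
by apply/commgP/eqP; exact: comm3.
Qed.

End Subgroups.

(** * The triple commutator of a 2-Engel group of class 3 *)

Section TwoEngelClassThree.
Context (G : groupType).
Hypothesis engel : two_engel G.
Hypothesis class3 : nilpotency_class 3 [set: G].

Let sT : is_subgroup [set: G]. Proof. by []. Qed.

Lemma comm3_central (x y z : G) : is_central [~ x, y, z]%g.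
Proof.
apply/is_centralP => w; apply/commgP/eqP.
have [n3 _] := class3.
have : lcs [set: G] 3 [~ [~ x, y, z], w]%g by do 3 apply: commg_lcsS => //.
by rewrite n3.
Qed.

Definition comm3 (x y z : G) : center G := Center (comm3_central x y z).

Lemma central_conjg (z g : G) : is_central z -> (z ^ g)%g = z.
Proof. by move=> /is_centralP/(_ g) c; apply/conjg_fixP; apply/commgP. Qed.

Lemma commMg (x y z : G) : [~ x * y, z]%g = ([~ x, z] ^ y * [~ y, z])%g.
Proof. by rewrite !commgEl !conjgE !gnorm. Qed.

Lemma commgM (x y z : G) : [~ x, y * z]%g = ([~ x, z] * [~ x, y] ^ z)%g.
Proof. by rewrite !commgEl !conjgE !gnorm. Qed.

Lemma commg_centralMl (u z w : G) : is_central z ->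
  [~ u * z, w]%g = [~ u, w]%g.
Proof.
move=> cz; have /is_centralP cz' := cz.
rewrite commMg (_ : [~ z, w]%g = 1%g) ?mulg1; last exact/eqP/commgP.
by apply/conjg_fixP/commgP/commute_sym.
Qed.

Lemma comm3M (x y x' y' z : G) :
  [~ [~ x, y] * [~ x', y'], z]%g = ([~ x, y, z] * [~ x', y', z])%g.
Proof. by rewrite commMg central_conjg//; exact: comm3_central. Qed.

Lemma conjg_comm (u w : G) : (u ^ w)%g = (u * [~ u, w])%g.
Proof. by rewrite commgEl mulVKg. Qed.

(** The commutator identities hold up to conjugation, and conjugating a commutator only multiplies
    it by a triple commutator, which is central and disappears in the next bracket. *)
Lemma comm3_alternating : alternating3 comm3.
Proof.
split=> [x x' y z|x y y' z|x y z z'|x y|x y|x y]; apply: val_inj => /=.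
- rewrite commMg conjg_comm -mulgA (is_centralP _ (comm3_central x y x')).
  by rewrite mulgA commg_centralMl ?comm3M//; exact: comm3_central.
- rewrite commgM conjg_comm mulgA commg_centralMl ?comm3M//.
    exact/is_centralP/comm3_central.
  exact: comm3_central.
- rewrite commgM central_conjg; last exact: comm3_central.
  exact/is_centralP/comm3_central.
- by rewrite commgg comm1g.
(* [[~ x, y]] is the inverse of [[~ y, x]], which commutes with [x] by the Engel condition. *)
- apply/eqP/commgP; rewrite -invgR; apply/commute_sym/commuteV/commute_sym.
  exact/commgP/eqP/engel.
- exact: engel.
Qed.

(** Otherwise the class would be at most 2, against the minimality of 3. *)
Lemma comm3_proper : exists a b c : G, comm3 a b c != 0.
Proof.
apply: contrapT => noabc; have [_ /(_ 2)] := class3.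
suff n2 : nilpotent_le 2 [set: G] by move=> /(_ n2).
apply/(nilpotent_le2 sT) => x y z _ _ _; apply: contrapT => xyz.
by apply: noabc; exists x, y, z; apply/eqP => /(congr1 val).
Qed.

(** Three arguments taken from two generators repeat one of them. Linearity then extends the
    vanishing to the generated subgroup, one argument at a time. *)
Lemma comm3_generated2 (a b : G) :
  let H := smallest (@is_subgroup G) [set a; b] in
  forall x y z, H x -> H y -> H z -> comm3 x y z = 0.
Proof.
move=> H; have alt := comm3_alternating; pose S := [set a; b].
have SSS x y z : S x -> S y -> S z -> comm3 x y z = 0.
  by move=> [->|->] [->|->] [->|->];
    rewrite ?(alt3_xxy alt) ?(alt3_xyx alt) ?(alt3_xyy alt).
have HSS x y z : S y -> S z -> H x -> comm3 x y z = 0.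
  move=> Sy Sz; apply: (@generated_sub _ S [set x | comm3 x y z = 0]).
    split=> /= [|u v cu cv|u cu]; first exact: (alt3_1l alt).
      by rewrite (alt3Ml alt) cu cv addr0.
    by rewrite (alt3Vl alt) cu oppr0.
  by move=> u Su; exact: SSS.
have HHS x y z : H x -> S z -> H y -> comm3 x y z = 0.
  move=> Hx Sz; apply: (@generated_sub _ S [set y | comm3 x y z = 0]).
    split=> /= [|u v cu cv|u cu]; first exact: (alt3_1m alt).
      by rewrite (alt3Mm alt) cu cv addr0.
    by rewrite (alt3Vm alt) cu oppr0.
  by move=> u Su; exact: HSS.
move=> x y z Hx Hy; apply: (@generated_sub _ S [set z | comm3 x y z = 0]).
  split=> /= [|u v cu cv|u cu]; first exact: (alt3_1r alt).
    by rewrite (alt3Mr alt) cu cv addr0.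
  by rewrite (alt3Vr alt) cu oppr0.
by move=> u Su; exact: HHS.
Qed.

(** The triple lies in the coset of [x ord0] modulo a subgroup with two generators. Hence E(3,G)
    contains every triangle, in particular the faces of any tetrahedron. *)
Lemma affinely_nil2_triple (x : {ffun 'I_3 -> G}) : affinely_nil2 G 2 x.
Proof.
pose u := ((x ord0)^-1 * x (inord 1))%g; pose v := ((x ord0)^-1 * x (inord 2))%g.
pose H := smallest (@is_subgroup G) [set u; v].
have sH : is_subgroup H by exact: generated_subgroup.
exists (x ord0), H; split=> //.
  apply/nilpotent_le2 => // p q r Hp Hq Hr.
  by have /(congr1 val) := comm3_generated2 Hp Hq Hr.
have [H1 _ _] := sH.
move=> i; exists ((x ord0)^-1 * x i)%g; last by rewrite mulVKg.
case: i => [[|[|[|//]]] p].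
- by rewrite (_ : Ordinal p = ord0) ?mulVg//; exact: val_inj.
- rewrite (_ : Ordinal p = inord 1); first by apply: sub_generated; left.
  by apply: val_inj; rewrite /= inordK.
- rewrite (_ : Ordinal p = inord 2); first by apply: sub_generated; right.
  by apply: val_inj; rewrite /= inordK.
Qed.

Lemma affinely_nil2_comm3 n (x : {ffun 'I_n.+1 -> G}) i j k l :
  affinely_nil2 G n x ->
  comm3 ((x i)^-1 * x j)%g ((x i)^-1 * x k)%g ((x i)^-1 * x l)%g = 0.
Proof.
move=> [y [H [sH /(nilpotent_le2 sH) nH Hx]]]; apply: val_inj => /=.
have Hd m : H ((x i)^-1 * x m)%g.
  have [h Hh ->] := Hx i; have [h' Hh' ->] := Hx m.
  have [_ HM HV] := sH.
  by rewrite invgM -mulgA mulKg; apply: HM => //; exact: HV.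
by apply: nH; exact: Hd.
Qed.

End TwoEngelClassThree.

(** * Discrete Stokes formula *)

Section DiscreteStokes.
Context (G : groupType) (A : zmodType) (om : G -> G -> G -> A).
Hypothesis alt : alternating3 om.

(** The value of [om] on a square cut along its diagonal from [p] to [r]. *)
Definition quad (p q r s : G) : A := om p q r + om p r s.

Lemma quad_const (p : G) : quad p p p p = 0.
Proof. by rewrite /quad (alt3_xxy alt) addr0. Qed.

Lemma quad_boundary (x p q r s : G) :
  om p q r = om x p q + om x q r + om x r p ->
  om p r s = om x p r + om x r s + om x s p ->
  quad p q r s = om x p q + om x q r + om x r s + om x s p.
Proof. by rewrite /quad => -> ->; rewrite (alt3C23 alt x p r); abel. Qed.

(** With [b00] as apex, each face becomes a sum over its four boundary edges, and every edge of the
    cube lies on two faces with opposite orientations. *)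
Lemma cube_stokes (b00 b10 b11 b01 t00 t10 t11 t01 : G) :
  {in [:: b00; b10; b11; b01; t00; t10; t11; t01] & &, forall x y z,
    om (b00^-1 * x)%g (b00^-1 * y)%g (b00^-1 * z)%g = 0} ->
  quad t00 t10 t11 t01 = quad b00 b10 b11 b01 +
    (quad b01 b11 t11 t01 - quad b00 b10 t10 t00) -
    (quad b10 b11 t11 t10 - quad b00 b01 t01 t00).
Proof.
move=> flat; have bd : {in [:: b00; b10; b11; b01; t00; t10; t11; t01] & &,
    forall x y z, om x y z = om b00 x y + om b00 y z + om b00 z x}.
  move=> x y z xl yl zl; have := flat x y z xl yl zl.
  by rewrite (alt3_affine alt) => /eqP; rewrite subr_eq0 => /eqP.
have qE p q r s : p \in [:: b00; b10; b11; b01; t00; t10; t11; t01] ->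
    q \in [:: b00; b10; b11; b01; t00; t10; t11; t01] ->
    r \in [:: b00; b10; b11; b01; t00; t10; t11; t01] ->
    s \in [:: b00; b10; b11; b01; t00; t10; t11; t01] ->
    quad p q r s = om b00 p q + om b00 q r + om b00 r s + om b00 s p.
  by move=> pl ql rl sl; apply: quad_boundary; exact: bd.
rewrite !qE; try by rewrite !inE !eqxx ?orbT.
rewrite !(alt3_xxy alt) !(alt3_xyx alt).
rewrite (alt3C23 alt b00 b01 b11) (alt3C23 alt b00 t00 t10).
rewrite (alt3C23 alt b00 t10 t11) (alt3C23 alt b00 b10 t10).
by rewrite (alt3C23 alt b00 b01 t01); abel.
Qed.

Section Slabs.
Context (N : nat) (y : nat -> nat -> nat -> G).

Definition slab k :=
  \sum_(0 <= i < N) \sum_(0 <= j < N)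
    quad (y i j k) (y i.+1 j k) (y i.+1 j.+1 k) (y i j.+1 k).

Hypothesis flat : forall i j k p q r p' q' r' p'' q'' r'',
  (i < N)%N -> (j < N)%N -> (k < N)%N ->
  (i <= p <= i.+1)%N -> (j <= q <= j.+1)%N -> (k <= r <= k.+1)%N ->
  (i <= p' <= i.+1)%N -> (j <= q' <= j.+1)%N -> (k <= r' <= k.+1)%N ->
  (i <= p'' <= i.+1)%N -> (j <= q'' <= j.+1)%N -> (k <= r'' <= k.+1)%N ->
  om ((y i j k)^-1 * y p q r)%g ((y i j k)^-1 * y p' q' r')%g
     ((y i j k)^-1 * y p'' q'' r'')%g = 0.

Hypothesis side1 : forall i j k, i = 0%N \/ i = N -> (j < N)%N -> (k < N)%N ->
  quad (y i j k) (y i j.+1 k) (y i j.+1 k.+1) (y i j k.+1) = 0.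
Hypothesis side2 : forall i j k, (i < N)%N -> j = 0%N \/ j = N -> (k < N)%N ->
  quad (y i j k) (y i.+1 j k) (y i.+1 j k.+1) (y i j k.+1) = 0.

(** Summing [cube_stokes] over one layer of unit cubes, the inner vertical faces telescope and the
    outer ones vanish by [side1] and [side2]. *)
Lemma slabS k : (k < N)%N -> slab k.+1 = slab k.
Proof.
move=> kN; pose X i j := quad (y i j k) (y i j.+1 k) (y i j.+1 k.+1) (y i j k.+1).
pose Y i j := quad (y i j k) (y i.+1 j k) (y i.+1 j k.+1) (y i j k.+1).
transitivity (slab k + \sum_(0 <= i < N) \sum_(0 <= j < N) (Y i j.+1 - Y i j)
    - \sum_(0 <= j < N) \sum_(0 <= i < N) (X i.+1 j - X i j)).
  rewrite [X in _ - X]exchange_big/= -big_split/= -sumrB.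
  apply: eq_big_nat => i iN; rewrite -big_split/= -sumrB.
  apply: eq_big_nat => j jN; apply: cube_stokes.
  have iN' : (i < N)%N by lia.
  have jN' : (j < N)%N by lia.
  pose cube p := exists p1 p2 p3, [/\ (i <= p1 <= i.+1)%N, (j <= p2 <= j.+1)%N,
    (k <= p3 <= k.+1)%N & p = y p1 p2 p3].
  have sub p : p \in [:: y i j k; y i.+1 j k; y i.+1 j.+1 k; y i j.+1 k;
      y i j k.+1; y i.+1 j k.+1; y i.+1 j.+1 k.+1; y i j.+1 k.+1] -> cube p.
    by rewrite !inE => /or4P[|||/or4P[|||/orP[]]]/eqP->;
      do 3 eexists; split; try reflexivity; rewrite ?leqnn ?leqnSn.
  move=> x x' x'' /sub[p1 [p2 [p3 [? ? ? ->]]]] /sub[q1 [q2 [q3 [? ? ? ->]]]].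
  by move=> /sub[r1 [r2 [r3 [? ? ? ->]]]]; exact: flat.
rewrite !big_nat [X in _ + X - _]big1 ?[X in _ - X]big1 ?addr0 ?subr0// => i iN.
  by rewrite telescope_sumr// /X !side1 ?subr0//;
    first [by left|by right|lia].
by rewrite telescope_sumr// /Y !side2 ?subr0//; first [by left|by right|lia].
Qed.

Lemma slab_const k : (k <= N)%N -> slab k = slab 0.
Proof. by elim: k => // k IH kN; rewrite slabS// IH// ltnW. Qed.

End Slabs.

(** Green's formula on a grid: interior edges cancel because [th] is antisymmetric, and the four
    sides of the square remain. *)
Lemma sum_boundary (th : G -> G -> A) (l : nat -> nat -> G) m n :
  (forall x y, th y x = - th x y) -> (m <= n)%N ->
  \sum_(m <= i < n) \sum_(m <= j < n) (th (l i j) (l i.+1 j) +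
     th (l i.+1 j) (l i.+1 j.+1) + th (l i.+1 j.+1) (l i j.+1) +
     th (l i j.+1) (l i j)) =
  \sum_(m <= i < n) (th (l i m) (l i.+1 m) - th (l i n) (l i.+1 n)) +
  \sum_(m <= j < n) (th (l n j) (l n j.+1) - th (l m j) (l m j.+1)).
Proof.
move=> thC mn.
transitivity (\sum_(m <= i < n) \sum_(m <= j < n)
    (- (th (l i j.+1) (l i.+1 j.+1) - th (l i j) (l i.+1 j))) +
  \sum_(m <= j < n) \sum_(m <= i < n)
    (th (l i.+1 j) (l i.+1 j.+1) - th (l i j) (l i j.+1))).
  rewrite [X in _ = _ + X]exchange_big/= -big_split/=; apply: eq_bigr => i _.
  rewrite -big_split/=; apply: eq_bigr => j _.
  by rewrite (thC (l i j.+1)) (thC (l i j) (l i j.+1)); abel.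
congr (_ + _); apply: eq_bigr => i _; last by rewrite telescope_sumr.
by rewrite sumrN telescope_sumr// opprB.
Qed.

(** * A Sperner count on the subdivided square *)

Section Sperner.
Context (a b c : G) (M : nat) (l : nat -> nat -> G).
Hypothesis colour : forall i j, (i <= 3 * M)%N -> (j <= 3 * M)%N ->
  [\/ l i j = 1%g /\ ~ (M <= i <= 2 * M /\ M <= j <= 2 * M)%N,
      l i j = a /\ (i < 2 * M)%N /\ (j < 2 * M)%N,
      l i j = b /\ (M < i)%N /\ (j < 2 * M)%N | l i j = c /\ (M < j)%N].

Let om0 (x y p q r : G) : [\/ p = 1%g, p = x | p = y] ->
  [\/ q = 1%g, q = x | q = y] -> [\/ r = 1%g, r = x | r = y] -> om p q r = 0.
Proof.
by move=> [->|->|->] [->|->|->] [->|->|->];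
  rewrite ?(alt3_1l alt, alt3_1m alt, alt3_1r alt, alt3_xxy alt, alt3_xyx alt,
    alt3_xyy alt).
Qed.

Let quad0 (x y p q r s : G) : [\/ p = 1%g, p = x | p = y] ->
  [\/ q = 1%g, q = x | q = y] -> [\/ r = 1%g, r = x | r = y] ->
  [\/ s = 1%g, s = x | s = y] -> quad p q r s = 0.
Proof. by move=> *; rewrite /quad !(@om0 x y) ?addr0. Qed.

(** On labels from [a], [b], [c] the form is the boundary sum with apex [a], by inspection of the 27
    cases. *)
Let om_abc (p q r : G) : [\/ p = a, p = b | p = c] ->
  [\/ q = a, q = b | q = c] -> [\/ r = a, r = b | r = c] ->
  om p q r = om a p q + om a q r + om a r p.
Proof.
have acb := alt3C23 alt a b c; have bac := alt3C12 alt a b c.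
have bca : om b c a = om a b c by rewrite (alt3C23 alt) bac opprK.
have cab : om c a b = om a b c by rewrite (alt3C12 alt) acb opprK.
have cba : om c b a = - om a b c by rewrite (alt3C23 alt) cab.
by move=> [->|->|->] [->|->|->] [->|->|->];
  rewrite ?(alt3_xxy alt, alt3_xyx alt, alt3_xyy alt) ?acb ?bac ?bca ?cab ?cba;
  abel.
Qed.

(** Only the middle ninth contributes, and there the sum reduces to its boundary. With apex [a],
    three sides give zero, and the side [i = 2 * M], which leads from [b] to [c], gives
    [om a b c]. *)
Lemma sperner : (0 < M)%N ->
  \sum_(0 <= i < 3 * M) \sum_(0 <= j < 3 * M)
    quad (l i j) (l i.+1 j) (l i.+1 j.+1) (l i j.+1) = om a b c.
Proof.
move=> M0; pose Q i j := quad (l i j) (l i.+1 j) (l i.+1 j.+1) (l i j.+1).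
have lo j : (j <= M)%N -> forall i, (i <= 3 * M)%N ->
    [\/ l i j = 1%g, l i j = a | l i j = b].
  by move=> jM i iM; case: (@colour i j); try lia;
    move=> [-> _]; [constructor 1|constructor 2|constructor 3].
have hi j : (2 * M <= j <= 3 * M)%N -> forall i, (i <= 3 * M)%N ->
    [\/ l i j = 1%g, l i j = c | l i j = c].
  by move=> jM i iM; case: (@colour i j); try lia;
    move=> [-> _]; [constructor 1|constructor 2].
have lf i : (i <= M)%N -> forall j, (j <= 3 * M)%N ->
    [\/ l i j = 1%g, l i j = a | l i j = c].
  by move=> iM j jM; case: (@colour i j); try lia;
    move=> [-> _]; [constructor 1|constructor 2|constructor 3].
have rt i : (2 * M <= i <= 3 * M)%N -> forall j, (j <= 3 * M)%N ->
    [\/ l i j = 1%g, l i j = b | l i j = c].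
  by move=> iM j jM; case: (@colour i j); try lia;
    move=> [-> _]; [constructor 1|constructor 2|constructor 3].
have ce i j : (M <= i <= 2 * M)%N -> (M <= j <= 2 * M)%N ->
    [\/ l i j = a, l i j = b | l i j = c].
  by move=> iM jM; case: (@colour i j); try lia;
    move=> [-> _]; [constructor 1|constructor 2|constructor 3].
(* A cell outside the middle ninth carries, besides 1, at most two of the labels [a], [b], [c]. *)
have Q0 i j : (i < 3 * M)%N -> (j < 3 * M)%N ->
    ~ (M <= i < 2 * M /\ M <= j < 2 * M)%N -> Q i j = 0.
  move=> iM jM ij; have [jlo|jlo] := ltnP j M.
    by apply: (@quad0 a b); apply: lo; lia.
  have [jhi|jhi] := leqP (2 * M)%N j.
    by apply: (@quad0 c c); apply: hi; lia.
  have [ilo|ilo] := ltnP i M; first by apply: (@quad0 a c); apply: lf; lia.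
  by apply: (@quad0 b c); apply: rt; lia.
transitivity (\sum_(M <= i < 2 * M) \sum_(M <= j < 2 * M) Q i j).
  rewrite (@big_cat_nat _ _ _ M)/=; try lia.
  rewrite [X in X + _]big_nat [X in X + _]big1 ?add0r; last first.
    by move=> i iM; rewrite big_nat big1// => j jM; apply: Q0; lia.
  rewrite (@big_cat_nat _ _ _ (2 * M)%N)/=; try lia.
  rewrite [X in _ + X]big_nat [X in _ + X]big1 ?addr0; last first.
    by move=> i iM; rewrite big_nat big1// => j jM; apply: Q0; lia.
  apply: eq_big_nat => i iM.
  rewrite (@big_cat_nat _ _ _ M)/=; try lia.
  rewrite [X in X + _]big_nat [X in X + _]big1 ?add0r; last first.
    by move=> j jM; apply: Q0; lia.
  rewrite (@big_cat_nat _ _ _ (2 * M)%N)/=; try lia.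
  rewrite [X in _ + X]big_nat [X in _ + X]big1 ?addr0//.
  by move=> j jM; apply: Q0; lia.
transitivity (\sum_(M <= i < 2 * M) \sum_(M <= j < 2 * M)
   (om a (l i j) (l i.+1 j) +
     om a (l i.+1 j) (l i.+1 j.+1) + om a (l i.+1 j.+1) (l i j.+1) +
     om a (l i j.+1) (l i j))).
  apply: eq_big_nat => i iM; apply: eq_big_nat => j jM.
  by apply: quad_boundary; apply: om_abc; apply: ce; lia.
rewrite sum_boundary; [|by move=> *; exact: (alt3C23 alt)|lia].
rewrite [X in X + _]big_nat [X in X + _]big1 ?add0r; last first.
  move=> i iM; rewrite (@om0 a b) ?(@om0 a c) ?subr0//; try by constructor 2.
  - by case: (@hi (2 * M)%N _ i) => [||->|->|->]; try lia;
      [constructor 1|constructor 3|constructor 3].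
  - by case: (@hi (2 * M)%N _ i.+1) => [||->|->|->]; try lia;
      [constructor 1|constructor 3|constructor 3].
  - by apply: lo; lia.
  - by apply: lo; lia.
(* A primitive of [om a] on labels in [b], [c], which makes the last side telescope. *)
pose chi x := if x == c then om a b c else 0.
transitivity (\sum_(M <= j < 2 * M) (chi (l (2 * M)%N j.+1) - chi (l (2 * M)%N j))).
  apply: eq_big_nat => j jM; rewrite [X in _ - X](@om0 a c).
  - have bc j' : (M <= j' <= 2 * M)%N ->
        l (2 * M)%N j' = b \/ l (2 * M)%N j' = c.
      by move=> j'M; case: (@colour (2 * M)%N j'); try lia;
        move=> [-> _]; [left|right].
    (* If [b] equals [c], the value [om a b c] is zero as well. *)
    have chib : chi b = 0 by rewrite /chi; case: eqP => // ->; exact: (alt3_xyy alt).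
    have chic : chi c = om a b c by rewrite /chi eqxx.
    rewrite subr0; case: (@bc j); [lia|move=> ->|move=> ->];
      case: (@bc j.+1); try lia; move=> ->; rewrite ?chib ?chic ?(alt3_xyy alt);
      rewrite ?subrr ?subr0 ?sub0r//; exact: (alt3C23 alt).
  - by constructor 2.
  - by apply: lf; lia.
  - by apply: lf; lia.
rewrite telescope_sumr; last lia.
have -> : l (2 * M)%N (2 * M)%N = c.
  by case: (@colour (2 * M)%N (2 * M)%N); try lia; case.
have -> : l (2 * M)%N M = b.
  by case: (@colour (2 * M)%N M); try lia; case.
rewrite /chi eqxx; case: eqP => [->|_]; last by rewrite subr0.
by rewrite (alt3_xyy alt) subr0.
Qed.

End Sperner.
End DiscreteStokes.

(** * Cocycles on a grid are coboundaries *)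

Section GridPotential.
Context (G : groupType) (N : nat).
Implicit Types p q r : nat * nat * nat.

(** Both points lie in the grid of side [N] and in a common unit cube; [adj N p p] thus says that
    [p] is a grid point. *)
Definition adj p q : bool :=
  [&& p.1.1 <= N, p.1.2 <= N, p.2 <= N, q.1.1 <= N, q.1.2 <= N & q.2 <= N]%N &&
  [&& p.1.1 <= q.1.1.+1, q.1.1 <= p.1.1.+1, p.1.2 <= q.1.2.+1,
      q.1.2 <= p.1.2.+1, p.2 <= q.2.+1 & q.2 <= p.2.+1]%N.

Context (e : nat * nat * nat -> nat * nat * nat -> G).
Hypothesis cocycle : forall p q r, adj p q -> adj q r -> adj p r ->
  (e p q * e q r)%g = e p r.

Definition grid_pred p := (p.1.1.-1, p.1.2.-1, p.2.-1).

(** The product of [e] along the path that lowers all positive coordinates at once; it has reached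
    the origin after [n] steps if no coordinate exceeds [n]. *)
Fixpoint potential n p : G :=
  if n is n'.+1 then (potential n' (grid_pred p) * e (grid_pred p) p)%g else 1%g.

(* For adjacent p and q, the coordinatewise minimum of p and q is adjacent to
   p, to q and to both of their predecessors. *)
Lemma potentialE n p q : adj p q ->
  (maxn (maxn p.1.1 p.1.2) p.2 <= n)%N -> (maxn (maxn q.1.1 q.1.2) q.2 <= n)%N ->
  (potential n p * e p q)%g = potential n q.
Proof.
elim: n p q => [|n IH] p q pq pn qn.
  have -> : p = (0, 0, 0)%N by case: p pn {pq} => -[? ?] ? /= ?; congr (_, _, _); lia.
  have -> : q = (0, 0, 0)%N by case: q qn {pq} => -[? ?] ? /= ?; congr (_, _, _); lia.
  rewrite /= mul1g; apply: (mulgI (e (0, 0, 0) (0, 0, 0))%N).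
  by rewrite cocycle ?mulg1.
pose m := (minn p.1.1 q.1.1, minn p.1.2 q.1.2, minn p.2 q.2).
have adjE : [/\ adj (grid_pred p) (grid_pred q), adj (grid_pred p) m,
    adj (grid_pred q) m & [/\ adj m p, adj m q, adj (grid_pred p) p &
    adj (grid_pred q) q]].
  move: pq; rewrite /m /grid_pred /adj /=; clear m pn qn IH.
  by case: p => -[? ?] ?; case: q => -[? ?] ? /=; split; [..|split]; lia.
case: adjE => pp pm qm [mp mq p'p q'q] /=.
rewrite -mulgA -(cocycle pm mp p'p) -mulgA (cocycle mp pq mq).
rewrite -(cocycle qm mq q'q) [RHS]mulgA -(IH (grid_pred p) (grid_pred q))//.
- by rewrite -(mulgA _ (e (grid_pred p) (grid_pred q))) (cocycle pp qm pm) mulgA.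
- by rewrite /=; lia.
- by rewrite /=; lia.
Qed.

End GridPotential.

(** * Mass of a label *)

Section Mass.
Context (R : realType).

(** On the unit interval, [F] is the distribution function of a probability measure without
    atoms. *)
Definition cdf (F : R -> R) : Prop :=
  [/\ continuous F, {homo F : x y / x <= y}, F 0 = 0 & F 1 = 1].

(** The coordinates of [t] cut the unit interval into consecutive pieces; the step function takes
    the value [x i] between [psum t i] and [psum t i.+1]. *)
Definition psum n (t : std_simplex R n) (j : nat) : R :=
  \sum_(k < n.+1 | (k < j)%N) val t ord0 k.

Lemma psum0 n (t : std_simplex R n) : psum t 0 = 0.
Proof. by rewrite /psum big_pred0. Qed.

Lemma psumn n (t : std_simplex R n) : psum t n.+1 = 1.
Proof.
have [_ <-] := set_mem (valP t); apply: eq_bigl => k.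
by rewrite ltn_ord.
Qed.

Lemma psumS n (t : std_simplex R n) (i : 'I_n.+1) :
  psum t i.+1 = psum t i + val t ord0 i.
Proof.
rewrite /psum (bigD1 i)/= ?ltnSn// addrC; congr (_ + _).
by apply: eq_bigl => k; rewrite ltnS ltn_neqAle andbC.
Qed.

Lemma sum_ord_diff n (u : nat -> R) c : (c <= n)%N ->
  \sum_(k < n | (k < c)%N) (u k.+1 - u k) = u c - u 0%N.
Proof.
move=> cn; rewrite -(big_ord_widen _ (fun k => u k.+1 - u k) cn).
by rewrite -(big_mkord xpredT (fun k => u k.+1 - u k)) telescope_sumr.
Qed.

(** The measure, with respect to [F], of the set on which the step function takes the value [g]. *)
Definition mass (G : groupType) (F : R -> R) (g : G) n
    (x : {ffun 'I_n.+1 -> G}) (t : std_simplex R n) : R :=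
  \sum_(i | x i == g) (F (psum t i.+1) - F (psum t i)).

Lemma initial_segment n (P : pred 'I_n) :
  (forall i j : 'I_n, (i <= j)%N -> P j -> P i) ->
  exists2 c, (c <= n)%N & forall k : 'I_n, P k = (k < c)%N.
Proof.
move=> dP; have [[k0 nk0]|/forallNP allP] := pselect (exists k, ~~ P k); last first.
  by exists n => // k; rewrite ltn_ord; have /negP/negPn := allP k.
have [c nc cmin] := @arg_minnP _ k0 (fun k => ~~ P k) val nk0.
exists c => [|k]; first exact/ltnW.
apply/idP/idP => [Pk|]; last by apply: contraTT => /cmin; rewrite -leqNgt.
by rewrite ltnNge; apply: contra nc => /dP; apply.
Qed.

Lemma psum_push m n (f : 'I_m.+1 -> 'I_n.+1) (t : std_simplex R m) j :
  psum (push f t) j = \sum_(k | (f k < j)%N) val t ord0 k.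
Proof.
rewrite /psum (partition_big f (fun j' : 'I_n.+1 => (j' < j)%N))//=.
apply: eq_bigr => j' j'j; rewrite mxE; apply: eq_bigl => k.
by case: eqP => [->|]; rewrite ?j'j ?andbF.
Qed.

(** A monotone vertex map merges consecutive pieces of the interval and leaves the step function
    unchanged. Faces and degeneracies are both of this kind. *)
Lemma mass_reindex (G : groupType) (F : R -> R) (g : G) m n
    (f : 'I_m.+1 -> 'I_n.+1) (x : {ffun 'I_n.+1 -> G}) (t : std_simplex R m) :
  {homo f : i j / (i <= j)%N} ->
  mass F g [ffun i => x (f i)] t = mass F g x (push f t).
Proof.
move=> mf; rewrite /mass.
rewrite (partition_big f (fun j : 'I_n.+1 => x j == g))/=; last first.
  by move=> i; rewrite ffunE.
apply: eq_bigr => j xj; pose d k := F (psum t k.+1) - F (psum t k).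
(* The indices sent below [i] form an initial segment, so their increments telescope. *)
have U i : \sum_(k | (f k < i)%N) d k = F (psum (push f t) i) - F 0.
  have [|c cm fc] := @initial_segment _ (fun k => (f k < i)%N).
    by move=> k k' /mf; exact: leq_ltn_trans.
  rewrite (eq_bigl _ _ fc) (@sum_ord_diff _ (fun k => F (psum t k)))// psum0.
  by rewrite psum_push (eq_bigl _ _ fc).
transitivity (\sum_(k | (f k < j.+1)%N) d k - \sum_(k | (f k < j)%N) d k);
  last by rewrite !U; lra.
apply/esym/eqP; rewrite subr_eq; apply/eqP.
rewrite (bigID (fun k => (f k < j)%N))/= addrC; congr (_ + _); apply: eq_bigl => k.
  rewrite ffunE -leqNgt ltnS -eqn_leq; case: (eqVneq (f k) j) => [->|fkj].
    by rewrite eqxx xj.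
  by rewrite andbF; apply/negP => /eqP/val_inj/eqP; apply/negP.
by case: (ltnP (f k) j) => [/ltnW fkj|]; rewrite ?andbT ?andbF// ltnS.
Qed.

End Mass.

Section MassTheory.
Context (R : realType) (G : groupType).
Implicit Types (F : R -> R) (g h : G).

Lemma psum_homo n (t : std_simplex R n) (i : 'I_n.+1) :
  psum t i <= psum t i.+1.
Proof. by rewrite psumS lerDl; have [] := set_mem (valP t). Qed.

Lemma psum_ge0 n (t : std_simplex R n) i : 0 <= psum t i.
Proof. by apply: sumr_ge0 => k _; have [] := set_mem (valP t). Qed.

Lemma psum_le1 n (t : std_simplex R n) i : psum t i <= 1.
Proof.
have [t0 <-] := set_mem (valP t); rewrite /psum.
by rewrite [leRHS](bigID (fun k : 'I_n.+1 => (k < i)%N))/= lerDl sumr_ge0.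
Qed.

Section Fixed.
Context (F : R -> R) (cF : cdf F) (n : nat).
Context (x : {ffun 'I_n.+1 -> G}) (t : std_simplex R n).

Let d (i : 'I_n.+1) := F (psum t i.+1) - F (psum t i).

Let d_ge0 i : 0 <= d i.
Proof. by rewrite subr_ge0; have [_ mF _ _] := cF; exact/mF/psum_homo. Qed.

(** The total mass is 1, so two disjoint level sets cannot both exceed one half. *)
Lemma mass_unique g h : 2^-1 < mass F g x t -> 2^-1 < mass F h x t -> g = h.
Proof.
move=> xg xh; apply/eqP; apply: contraTT xh => gh; rewrite -leNgt.
have : \sum_i d i = 1.
  have [_ _ F0 F1] := cF.
  have := @sum_ord_diff _ n.+1 (fun k => F (psum t k)) n.+1 (leqnn _).
  rewrite psumn psum0 F0 F1 subr0 => <-.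
  by apply: eq_bigl => k; rewrite ltn_ord.
rewrite (bigID (fun i => x i == g))/= (bigID (fun i => x i == h))/=.
rewrite (bigID (fun i => x i == h) (fun i => x i != g))/=.
rewrite [X in X + _ + _]big_pred0 => [|i]; last first.
  by case: (eqVneq (x i) g) => //= ->; exact: negPf.
rewrite [\sum_(i | (x i != g) && (x i == h)) _](eq_bigl (fun i => x i == h));
  last first.
  by move=> i; case: (eqVneq (x i) h) => [->|]; rewrite ?andbF// eq_sym gh.
have -> : \sum_(i | (x i == g) && (x i != h)) d i = mass F g x t.
  by apply: eq_bigl => i; case: (eqVneq (x i) g) => [->|].
rewrite -[\sum_(i | x i == h) _]/(mass F h x t).
have : 0 <= \sum_(i | (x i != g) && (x i != h)) d i by exact: sumr_ge0.
move: xg; lra.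
Qed.

Lemma mass_support g : 2^-1 < mass F g x t ->
  exists i, x i = g /\ val t ord0 i != 0.
Proof.
move=> xg; apply: contrapT => noi; move: xg; rewrite /mass big1 ?ltNge ?ler0n//.
  by rewrite invr_ge0 ler0n.
move=> i /eqP xi; rewrite psumS; suff -> : val t ord0 i = 0 by rewrite addr0 subrr.
by apply/eqP; apply: contrapT => /negP ti; apply: noi; exists i.
Qed.

Lemma mass_ge g i : x i = g -> d i <= mass F g x t.
Proof.
move=> xi; rewrite /mass (bigD1 i) ?xi//= lerDl.
by apply: sumr_ge0 => k _; exact: d_ge0.
Qed.

End Fixed.

Definition clamp (z : R) : R := Num.max 0 (Num.min 1 z).

Lemma clamp_itv z : 0 <= clamp z <= 1.
Proof. by rewrite /clamp minElt; case: ltP => ?; rewrite maxElt; case: ltP; lra. Qed.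

Lemma clamp0 z : z <= 0 -> clamp z = 0.
Proof. by rewrite /clamp minElt; case: ltP => ?; rewrite maxElt; case: ltP; lra. Qed.

Lemma clamp1 z : 1 <= z -> clamp z = 1.
Proof. by rewrite /clamp minElt; case: ltP => ?; rewrite maxElt; case: ltP; lra. Qed.

Lemma clamp_homo : {homo clamp : x y / x <= y}.
Proof.
move=> x y; rewrite /clamp !minElt.
by case: ltP => ?; case: ltP => ?; rewrite !maxElt; case: ltP => ?; case: ltP; lra.
Qed.

Lemma clamp_continuous : continuous clamp.
Proof.
move=> z; apply: (@continuous_max R R (fun=> 0) (Num.min 1)).
  exact: cvg_cst.
apply: (@continuous_min R R (fun=> 1) id); first exact: cvg_cst.
exact: cvg_id.
Qed.

(** Take for [F] the uniform distribution on a piece of positive length; all the mass then sits on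
    the value taken there. *)
Lemma mass_exists n (x : {ffun 'I_n.+1 -> G}) (t : std_simplex R n) :
  exists F g, cdf F /\ 2^-1 < mass F g x t.
Proof.
have [i ti] : exists i, 0 < val t ord0 i.
  have [t0 t1] := set_mem (valP t); apply: contrapT => noi.
  have : \sum_i val t ord0 i = 0.
    apply: big1 => i _; apply/eqP; rewrite eq_le t0 andbT leNgt.
    by apply/negP => ti; apply: noi; exists i.
  by rewrite t1 => /eqP; rewrite oner_eq0.
pose F z := clamp ((val t ord0 i)^-1 * z + - (val t ord0 i)^-1 * psum t i).
have cF : cdf F.
  split.
  - move=> z; apply: (@continuous_comp _ _ _ (fun z => (val t ord0 i)^-1 * z +
      - (val t ord0 i)^-1 * psum t i) clamp); last exact: clamp_continuous.
    by apply: (@continuousD _ R^o R^o (fun x => (val t ord0 i)^-1 * x)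
      (fun=> _)); [exact: mulrl_continuous|exact: cvg_cst].
  - by move=> y z yz; apply: clamp_homo; rewrite lerD2r ler_pM2l// invr_gt0.
  - rewrite /F mulr0 add0r clamp0// mulNr oppr_le0 mulr_ge0 ?psum_ge0//.
    by rewrite invr_ge0 ltW.
  - rewrite /F mulNr -mulrBr clamp1// -[leLHS](mulVf (lt0r_neq0 ti)).
    rewrite ler_pM2l ?invr_gt0// lerBrDl -psumS; exact: psum_le1.
exists F, (x i); split=> //; apply: lt_le_trans (mass_ge cF t (erefl (x i))).
rewrite /F psumS mulNr -!mulrBr subrr mulr0 (clamp0 (lexx 0)) subr0.
by rewrite [psum t i + _]addrC addrK mulVf ?lt0r_neq0// clamp1//; lra.
Qed.

Lemma psum_continuous n j : continuous (fun t : std_simplex R n => psum t j).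
Proof.
apply: continuous_big => [|k _]; first exact: add_continuous.
move=> t; apply: (@continuous_comp _ _ _ (val : std_simplex R n -> 'rV[R]_n.+1)
  (fun v => v ord0 k)); last exact: coord_continuous.
exact: initial_continuous.
Qed.

Lemma mass_continuous F g n (x : {ffun 'I_n.+1 -> G}) : continuous F ->
  continuous (mass F g x : std_simplex R n -> R).
Proof.
move=> cF; apply: continuous_big => [|k _]; first exact: add_continuous.
move=> t; apply: (@continuousB _ R^o _ (fun t : std_simplex R n => F (psum t k.+1))
    (fun t => F (psum t k)));
  by apply: continuous_comp; [exact: psum_continuous|exact: cF].
Qed.

End MassTheory.

(** * Labels on E(3,G) and transitions on B(3,G) *)

Section QuotientSpace.
Context (T : topologicalType) (r : T -> T -> Prop).

Lemma open_quotient (U : set (quotient_space r)) (V : set T) :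
  open V -> (forall x, U (class_of r x) <-> V x) -> open U.
Proof.
move=> oV UV; suff VE : V = class_of r @^-1` U by rewrite VE in oV.
by apply/seteqP; split=> x /UV.
Qed.

Lemma class_of_continuous : continuous (class_of r).
Proof. exact: pi_continuous. Qed.

End QuotientSpace.

Section Labels.
Context (R : realType) (G : groupType).
Implicit Types (F : R -> R) (g h : G).

Definition cell_mass F g (c : cells R (E3_sset G)) : R :=
  mass F g (val (tagged (tag c) : affinely_nil2 G _)) (tagged c).

Lemma cell_mass_glue F g c d : Defs.glue c d -> cell_mass F g c = cell_mass F g d.
Proof.
case=> [n i x t|n i x t]; rewrite /cell_mass /=; apply: mass_reindex => j k.
  by rewrite /= /bump; lia.
by rewrite /= /unbump; lia.
Qed.

Definition E3_mass F g (p : E3 G R) : R := cell_mass F g (rep_of p).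

Lemma E3_mass_class F g (c : cells R (E3_sset G)) :
  E3_mass F g (class_of (@Defs.glue R _) c) = cell_mass F g c.
Proof.
have /class_ofP : class_of (@Defs.glue R (E3_sset G))
    (rep_of (class_of (@Defs.glue R _) c)) =
  class_of (@Defs.glue R _) c by rewrite rep_ofK.
rewrite /E3_mass; move: (rep_of _) => d.
by elim=> {c d} [? ? /cell_mass_glue//|//|? ? _ ->//|? ? ? _ -> _ ->//].
Qed.

Lemma E3_mass_rpoint F g n (x : affinely_nil2 G n) (t : std_simplex R n) :
  E3_mass F g (rpoint (x : E3_sset G n) t) = mass F g (val x) t.
Proof. exact: E3_mass_class. Qed.

Definition label F g (p : E3 G R) : Prop := 2^-1 < E3_mass F g p.

(* Inferring implicit arguments would unfold [open] in the iterated quotient. *)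
Unset Implicit Arguments.

(** Openness is tested on each cell separately, where [mass] is continuous in the barycentric
    coordinates. *)
Lemma open_label F g : cdf F -> open (label F g).
Proof.
move=> [cF _ _ _].
apply: (@open_quotient _ (@Defs.glue R (E3_sset G)) _
  [set c | 2^-1 < cell_mass F g c]).
  apply/sigT_openP => -[n x].
  apply: (@open_comp (std_simplex R n) R
    (mass F g (val (x : affinely_nil2 G n))) [set z : R | 2^-1 < z]).
    by move=> t _; exact: mass_continuous.
  exact: open_gt.
by move=> c; rewrite /label E3_mass_class.
Qed.

Set Implicit Arguments.

Lemma E3_ind (Q : E3 G R -> Prop) :
  (forall n (x : affinely_nil2 G n) t, Q (rpoint (x : E3_sset G n) t)) ->
  forall p, Q p.
Proof.
move=> Qr p; rewrite -(rep_ofK p); case: (rep_of p) => -[n x] t; exact: Qr.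
Qed.

Lemma label_unique F g h p : cdf F -> label F g p -> label F h p -> g = h.
Proof. by move=> cF; exact: mass_unique. Qed.

Lemma label_exists p : exists F g, cdf F /\ label F g p.
Proof. by exact: mass_exists. Qed.

Lemma label_support F g n (x : affinely_nil2 G n) (t : std_simplex R n) :
  label F g (rpoint (x : E3_sset G n) t) ->
  exists i, val x i = g /\ val t ord0 i != 0.
Proof. by rewrite /label E3_mass_rpoint; exact: mass_support. Qed.

Lemma label_act F g h p : label F (h * g)%g (E3_act h p) <-> label F g p.
Proof.
elim/E3_ind: p => n x t; rewrite /E3_act realization_mapE /label.
rewrite (@E3_mass_rpoint F _ _ (translate h x)) E3_mass_rpoint.
suff -> : mass F (h * g)%g (val (translate h x)) t = mass F g (val x) t by [].
by apply: eq_bigl => i; rewrite /= ffunE (inj_eq (mulgI h)).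
Qed.

(** Left translation multiplies both labels on the left and keeps [g], so this depends on the orbit
    only. [transition F F 1%g b] says that [F] has a label over [b]. *)
Definition transition F F' g (b : B3 G R) : Prop :=
  exists h, label F h (rep_of b) /\ label F' (h * g)%g (rep_of b).

Lemma transition_class F F' g (p : E3 G R) :
  transition F F' g (class_of (@E3_orbit G R) p) <->
  exists h, label F h p /\ label F' (h * g)%g p.
Proof.
have /class_ofP : class_of (@E3_orbit G R) (rep_of (class_of (@E3_orbit G R) p)) =
  class_of (@E3_orbit G R) p by rewrite rep_ofK.
rewrite /transition; move: (rep_of _) => q.
elim=> {p q} [p _ [k ->]|//|? ? _ IH|? ? ? _ IH1 _ IH2].
- split=> -[h [lh lh']].
    by exists (k * h)%g; rewrite -mulgA; split; apply/label_act.
  by exists (k^-1 * h)%g; rewrite -mulgA; split; apply/(label_act _ _ k);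
    rewrite mulVKg.
- exact: iff_sym.
- exact: iff_trans IH1 IH2.
Qed.

Unset Implicit Arguments.

Lemma open_transition F F' g : cdf F -> cdf F' -> open (transition F F' g).
Proof.
move=> cF cF'; apply: (@open_quotient _ (@E3_orbit G R) _
  (\bigcup_h (label F h `&` label F' (h * g)%g))).
  by apply: bigcup_open => h _; apply: openI; exact: open_label.
move=> p; split=> [/transition_class[h ?]|[h _ ?]]; first by exists h.
by apply/transition_class; exists h.
Qed.

Set Implicit Arguments.

Lemma transition_unique F F' g g' b : cdf F -> cdf F' ->
  transition F F' g b -> transition F F' g' b -> g = g'.
Proof.
move=> cF cF' [h [lh lh']] [k [lk lk']].
have hk := label_unique cF lh lk; rewrite -hk in lk'.
exact/(mulgI h)/(label_unique cF' lh' lk').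
Qed.

Lemma transition_comp F F' F'' g g' b : cdf F' ->
  transition F F' g b -> transition F' F'' g' b -> transition F F'' (g * g')%g b.
Proof.
move=> cF' [h [lh lh']] [k [lk lk']]; exists h; split=> //.
by rewrite mulgA (label_unique cF' lh' lk).
Qed.

Lemma transition_total F F' b : transition F F 1%g b -> transition F' F' 1%g b ->
  exists g, transition F F' g b.
Proof.
move=> [h [lh _]] [k [lk _]]; exists (h^-1 * k)%g; exists h.
by rewrite mulVKg.
Qed.

Lemma transition_exists b : exists F, cdf F /\ transition F F 1%g b.
Proof.
by have [F [g [cF lg]]] := label_exists (rep_of b); exists F; split=> //;
  exists g; rewrite mulg1.
Qed.

(** At a point over [b], the labels [h], [h * g1], [h * g2] and [h * g3] are vertices of one
    simplex, and [h] cancels in the quotients. *)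
Lemma transition_flat (A : zmodType) (om : G -> G -> G -> A) F F1 F2 F3 g1 g2 g3 b :
  (forall n (x : {ffun 'I_n.+1 -> G}) i j k l, affinely_nil2 G n x ->
     om ((x i)^-1 * x j)%g ((x i)^-1 * x k)%g ((x i)^-1 * x l)%g = 0) ->
  cdf F -> transition F F1 g1 b -> transition F F2 g2 b ->
  transition F F3 g3 b -> om g1 g2 g3 = 0.
Proof.
move=> flat cF [h [lh l1]] [h' [lh' l2]] [h'' [lh'' l3]].
rewrite -(label_unique cF lh lh') in l2; rewrite -(label_unique cF lh lh'') in l3.
move: (rep_of b) lh l1 l2 l3 {lh' lh''}; elim/E3_ind=> n x t.
move=> /label_support[i [xi _]] /label_support[j [xj _]].
move=> /label_support[k [xk _]] /label_support[l [xl _]].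
have gE g y : (h * g)%g = y -> g = (h^-1 * y)%g by move=> <-; rewrite mulKg.
rewrite (gE _ _ (esym xj)) (gE _ _ (esym xk)) (gE _ _ (esym xl)) -xi.
exact/flat/set_mem/(valP x).
Qed.

End Labels.

(** * The tetrahedral sphere *)

Section Sphere.
Context (R : realType) (G : groupType).
Hypothesis nil2_triple : forall x : {ffun 'I_3 -> G}, affinely_nil2 G 2 x.

Definition triangle (x y z : G) : affinely_nil2 G 2 :=
  exist (fun u => u \in affinely_nil2 G 2) [ffun i : 'I_3 => nth 1%g [:: x; y; z] i]
    (mem_set (nil2_triple _)).

Let o31 : 'I_3 := Ordinal (isT : (1 < 3)%N).
Let o32 : 'I_3 := Ordinal (isT : (2 < 3)%N).
Let o21 : 'I_2 := Ordinal (isT : (1 < 2)%N).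

(** Taken as a face of a degenerate triangle, so that [nil2_triple] covers edges and vertices
    too. *)
Definition edge (x y : G) : affinely_nil2 G 1 := E3_face o32 (triangle x y y).
Definition vertex (x : G) : affinely_nil2 G 0 := E3_face o21 (edge x x).

Lemma triangle_face2 x y z : E3_face o32 (triangle x y z) = edge x y.
Proof. by apply/val_inj/ffunP => -[[|[|//]] p]; rewrite !ffunE. Qed.

Lemma triangle_face1 x y z : E3_face o31 (triangle x y z) = edge x z.
Proof. by apply/val_inj/ffunP => -[[|[|//]] p]; rewrite !ffunE. Qed.

Lemma triangle_face0 x y z : E3_face ord0 (triangle x y z) = edge y z.
Proof. by apply/val_inj/ffunP => -[[|[|//]] p]; rewrite !ffunE. Qed.

Lemma edge_face1 x y : E3_face o21 (edge x y) = vertex x.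
Proof. by apply/val_inj/ffunP => -[[|//] p]; rewrite !ffunE. Qed.

(* Barycentric coordinates of the triangle, with al the join parameter between
   the first vertex and the opposite edge, on which be is the position. *)
Fact tri_coord_subproof (al be : R) :
  (\row_(i < 3) nth 0 [:: 1 - clamp al; clamp al * (1 - clamp be);
     clamp al * clamp be] i) \in std_simplex R 2.
Proof.
apply/mem_set; have /andP[a0 a1] := clamp_itv al; have /andP[b0 b1] := clamp_itv be.
split=> [[[|[|[|//]]] p]|]; rewrite ?mxE/=.
- by rewrite subr_ge0.
- by rewrite mulr_ge0// subr_ge0.
- by rewrite mulr_ge0.
- by rewrite !big_ord_recl big_ord0 !mxE/=; lra.
Qed.

Definition tri_coord al be : std_simplex R 2 :=
  exist (fun u => u \in std_simplex R 2) _ (tri_coord_subproof al be).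

Fact edge_coord_subproof (be : R) :
  (\row_(i < 2) nth 0 [:: 1 - clamp be; clamp be] i) \in std_simplex R 1.
Proof.
apply/mem_set; have /andP[b0 b1] := clamp_itv be.
split=> [[[|[|//]] p]|]; rewrite ?mxE/=; [by rewrite subr_ge0|by []|].
by rewrite !big_ord_recl big_ord0 !mxE/=; lra.
Qed.

Definition edge_coord be : std_simplex R 1 :=
  exist (fun u => u \in std_simplex R 1) _ (edge_coord_subproof be).

Fact vertex_coord_subproof : (\row_(i < 1) 1) \in std_simplex R 0.
Proof.
apply/mem_set; split=> [i|]; first by rewrite mxE.
by rewrite big_ord_recl big_ord0 mxE addr0.
Qed.

Definition vertex_coord : std_simplex R 0 :=
  exist (fun u => u \in std_simplex R 0) _ vertex_coord_subproof.

Definition tri_point x y z al be : E3 G R :=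
  rpoint (triangle x y z : E3_sset G 2) (tri_coord al be).
Definition edge_point x y be : E3 G R :=
  rpoint (edge x y : E3_sset G 1) (edge_coord be).
Definition vertex_point x : E3 G R :=
  rpoint (vertex x : E3_sset G 0) vertex_coord.

Lemma rpoint_face n (i : 'I_n.+2) (x : affinely_nil2 G n.+1) (t : std_simplex R n) :
  rpoint (x : E3_sset G n.+1) (push (lift i) t) =
  rpoint (E3_face i x : E3_sset G n) t.
Proof. by apply/esym/class_ofP/rst_step; exact: (@glue_face R (E3_sset G)). Qed.

Ltac coord_tac := apply/val_inj/rowP => -[[|[|[|//]]] p];
  rewrite ?mxE ?big_mkcond/= ?big_ord_recl ?big_ord0/= ?mxE/=.

Lemma tri_point_be0 x y z al be : clamp be = 0 ->
  tri_point x y z al be = edge_point x y al.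
Proof.
move=> b0; rewrite /edge_point -(triangle_face2 x y z) -rpoint_face.
by congr rpoint; coord_tac; rewrite ?b0; lra.
Qed.

Lemma tri_point_be1 x y z al be : clamp be = 1 ->
  tri_point x y z al be = edge_point x z al.
Proof.
move=> b1; rewrite /edge_point -(triangle_face1 x y z) -rpoint_face.
by congr rpoint; coord_tac; rewrite ?b1; lra.
Qed.

Lemma tri_point_al1 x y z al be : clamp al = 1 ->
  tri_point x y z al be = edge_point y z be.
Proof.
move=> a1; rewrite /edge_point -(triangle_face0 x y z) -rpoint_face.
by congr rpoint; coord_tac; rewrite ?a1; lra.
Qed.

Lemma edge_point_0 x y be : clamp be = 0 -> edge_point x y be = vertex_point x.
Proof.
move=> b0; rewrite /vertex_point -(edge_face1 x y) -rpoint_face.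
by congr rpoint; coord_tac; rewrite ?b0; lra.
Qed.

Lemma tri_point_al0 x y z al be : clamp al = 0 ->
  tri_point x y z al be = vertex_point x.
Proof.
move=> a0; rewrite -(edge_point_0 x y a0) -(tri_point_be0 x y z al (clamp0 (lexx 0))).
by congr rpoint; coord_tac; rewrite ?a0; lra.
Qed.

Lemma row_continuous (T : topologicalType) n (h : T -> 'rV[R]_n) :
  (forall j, continuous (fun z => h z ord0 j)) -> continuous h.
Proof.
move=> ch z U /= [P /= Pnbhs PU].
suff : \forall s \near z, forall i j, P i j (h s i j).
  by apply: filterS => s; exact: PU.
apply: filter_forall => i; apply: filter_forall => j.
by rewrite (ord1 i); exact: (ch j z _ (Pnbhs ord0 j)).
Qed.

Unset Implicit Arguments.

Lemma tri_point_continuous (T : topologicalType) x y z (al be : T -> R) :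
  continuous al -> continuous be ->
  continuous (fun s => tri_point x y z (al s) (be s)).
Proof.
move=> ca cb.
have cca : continuous (fun s => clamp (al s)).
  by move=> s; apply: continuous_comp; [exact: ca|exact: clamp_continuous].
have ccb : continuous (fun s => clamp (be s)).
  by move=> s; apply: continuous_comp; [exact: cb|exact: clamp_continuous].
have cc : continuous (fun s => tri_coord (al s) (be s)).
  apply: continuous_comp_initial; apply: row_continuous => -[[|[|[|//]]] p] s.
  - rewrite /continuous_at; under eq_cvg do rewrite mxE/=.
    by rewrite mxE/=; apply: cvgB; [exact: cvg_cst|exact: cca].
  - rewrite /continuous_at; under eq_cvg do rewrite mxE/=.
    rewrite mxE/=; apply: cvgM; first exact: cca.
    by apply: cvgB; [exact: cvg_cst|exact: ccb].
  - rewrite /continuous_at; under eq_cvg do rewrite mxE/=.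
    by rewrite mxE/=; apply: cvgM; [exact: cca|exact: ccb].
move=> s; apply: (@continuous_comp _ _ _ (fun s => cell (triangle x y z : E3_sset G 2)
  (tri_coord (al s) (be s))) (class_of (@Defs.glue R (E3_sset G)))); last first.
  exact: class_of_continuous.
apply: (@continuous_comp _ _ _ (fun s => tri_coord (al s) (be s))
  (cell (triangle x y z : E3_sset G 2))); first exact: cc.
exact: existT_continuous.
Qed.

Set Implicit Arguments.

Section Map.
Context (a b c : G).
Implicit Type z : 'rV[R]_2.

(** Coordinates running over the unit interval on the middle ninth, [yparam] downwards. *)
Definition xparam z : R := 3 * z ord0 ord0 - 1.
Definition yparam z : R := 2 - 3 * z ord0 o21.
(** The cone parameter: 1 exactly on the middle ninth, 0 on the boundary of the square. *)
Definition collar z : R :=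
  clamp (3 * z ord0 ord0) * clamp (3 - 3 * z ord0 ord0) *
  (clamp (3 * z ord0 o21) * clamp (3 - 3 * z ord0 o21)).

(* The boundary of the tetrahedron on 1, a, b, c: the middle ninth of the square
   covers the face a b c and the collar around it is the cone with apex 1. *)
Definition sphere z : E3 G R :=
  if clamp (xparam z) * clamp (yparam z) == 0
  then tri_point 1%g c a (collar z) (yparam z)
  else if clamp (xparam z) == 1 then tri_point 1%g c b (collar z) (yparam z)
  else if clamp (yparam z) == 1 then tri_point 1%g a b (collar z) (xparam z)
  else tri_point c a b (yparam z) (xparam z).

Lemma collar_itv z : 0 <= collar z <= 1.
Proof.
rewrite /collar; have := clamp_itv (3 * z ord0 ord0).
have := clamp_itv (3 - 3 * z ord0 ord0); have := clamp_itv (3 * z ord0 o21).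
have := clamp_itv (3 - 3 * z ord0 o21).
move=> /andP[? ?] /andP[? ?] /andP[? ?] /andP[? ?].
by rewrite !mulr_ge0//= !mulr_ile1// ?mulr_ge0.
Qed.

Lemma clamp_collar z : clamp (collar z) = collar z.
Proof.
by have := collar_itv z; rewrite /clamp minElt; case: ltP => ?; rewrite maxElt;
  case: ltP; lra.
Qed.

Lemma collar1 z : 0 <= xparam z <= 1 -> 0 <= yparam z <= 1 -> collar z = 1.
Proof.
rewrite /xparam /yparam /collar => *.
by rewrite !clamp1 ?mulr1//; lra.
Qed.

Lemma clamp_inside (r : R) : clamp r != 0 -> clamp r != 1 -> 0 <= r <= 1.
Proof.
move=> r0 r1; apply/andP; split; rewrite leNgt; apply/negP => rlt.
  by rewrite clamp0 ?eqxx// ltW in r0.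
by rewrite clamp1 ?eqxx// ltW in r1.
Qed.

Lemma sphere_collar0 z : collar z = 0 -> sphere z = vertex_point 1%g.
Proof.
move=> z0; have cz : clamp (collar z) = 0 by rewrite clamp_collar.
rewrite /sphere; case: ifPn => [_|]; first exact: tri_point_al0.
rewrite mulf_eq0 => /norP[x0 y0]; case: ifPn => [_|x1]; first exact: tri_point_al0.
case: ifPn => [_|y1]; first exact: tri_point_al0.
by move: z0; rewrite collar1 ?clamp_inside// => /eqP; rewrite oner_eq0.
Qed.

Lemma sphere_boundary z : cube_boundary R 2 z -> sphere z = vertex_point 1%g.
Proof.
move=> [_ [[[|[|//]] p] zi]]; apply: sphere_collar0; move: zi; rewrite /collar.
  rewrite (_ : Ordinal p = ord0); last exact: val_inj.
  by move=> [->|->]; [rewrite (@clamp0 _ (3 * 0))|rewrite (@clamp0 _ (3 - 3 * 1))];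
    rewrite ?(mul0r, mulr0)//; lra.
rewrite (_ : Ordinal p = o21); last exact: val_inj.
by move=> [->|->]; [rewrite (@clamp0 _ (3 * 0))|rewrite (@clamp0 _ (3 - 3 * 1))];
  rewrite ?(mul0r, mulr0)//; lra.
Qed.

Lemma label_vertex_point F g x : label F g (vertex_point x) -> g = x.
Proof. by move=> /label_support[[[|//] p] [<- _]]; rewrite /= !ffunE. Qed.

Lemma label_tri_point F g (x y w : G) al be : label F g (tri_point x y w al be) ->
  [\/ g = x /\ clamp al != 1, g = y /\ clamp al != 0 /\ clamp be != 1 |
      g = w /\ clamp al != 0 /\ clamp be != 0].
Proof.
move=> /label_support[[[|[|[|//]]] p] [<-]]; rewrite mxE/= ffunE/=.
- by rewrite subr_eq0 eq_sym; constructor 1.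
- by rewrite mulf_eq0 subr_eq0 [1 == _]eq_sym => /norP; constructor 2.
- by rewrite mulf_eq0 => /norP; constructor 3.
Qed.

(** On grid points these four cases become the colouring condition of the Sperner count. *)
Lemma label_sphere F g z : label F g (sphere z) ->
  [\/ g = 1%g /\ collar z != 1,
      g = a /\ clamp (xparam z) != 1 /\ clamp (yparam z) != 0,
      g = b /\ clamp (xparam z) != 0 /\ clamp (yparam z) != 0 |
      g = c /\ clamp (yparam z) != 1].
Proof.
rewrite /sphere; case: ifPn => [|].
  rewrite mulf_eq0 => xy /label_tri_point; rewrite clamp_collar.
  case=> [[-> ?]|[-> [_ ?]]|[-> [_ y0]]]; [by constructor 1|by constructor 4|].
  constructor 2; rewrite y0; move: xy; rewrite (negPf y0) orbF => /eqP ->.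
  by rewrite eq_sym oner_neq0.
rewrite mulf_eq0 => /norP[x0 y0]; case: ifPn => [_|x1].
  move=> /label_tri_point; rewrite clamp_collar.
  by case=> [[-> ?]|[-> [_ ?]]|[-> _]];
    [constructor 1|constructor 4|constructor 3].
case: ifPn => [_|y1].
  move=> /label_tri_point; rewrite clamp_collar.
  by case=> [[-> ?]|[-> _]|[-> _]]; [constructor 1|constructor 2|constructor 3].
by move=> /label_tri_point[[-> ?]|[-> _]|[-> _]];
  [constructor 4|constructor 2|constructor 3].
Qed.

Lemma sphere_3 z : clamp (xparam z) * clamp (yparam z) = 0 ->
  sphere z = tri_point 1%g c a (collar z) (yparam z).
Proof. by rewrite /sphere => ->; rewrite eqxx. Qed.

(** Where an earlier branch of [sphere] applies, both formulas reduce to the same edge of the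
    tetrahedron; likewise for the next two pieces. *)
Lemma sphere_2 z : clamp (xparam z) = 1 ->
  sphere z = tri_point 1%g c b (collar z) (yparam z).
Proof.
move=> x1; rewrite /sphere x1 eqxx mul1r; case: eqP => // y0.
by rewrite !tri_point_be0.
Qed.

Lemma sphere_1 z : clamp (yparam z) = 1 ->
  sphere z = tri_point 1%g a b (collar z) (xparam z).
Proof.
move=> y1; rewrite /sphere y1 eqxx mulr1; case: eqP => x0.
  by rewrite tri_point_be1// tri_point_be0.
by case: eqP => // x1; rewrite !tri_point_be1.
Qed.

Lemma sphere_0 z : collar z = 1 ->
  sphere z = tri_point c a b (yparam z) (xparam z).
Proof.
move=> z1; have cz : clamp (collar z) = 1 by rewrite clamp_collar.
rewrite /sphere; case: eqP => [/eqP|_].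
  rewrite mulf_eq0 (tri_point_al1 _ _ _ _ cz) => /orP[] /eqP e.
    by rewrite tri_point_be0.
  by rewrite tri_point_al0// edge_point_0.
case: eqP => [x1|_]; first by rewrite (tri_point_al1 _ _ _ _ cz) tri_point_be1.
by case: eqP => // y1; rewrite (tri_point_al1 _ _ _ _ cz) tri_point_al1.
Qed.

Lemma coord_affine_continuous (i : 'I_2) (r s : R) :
  continuous (fun z : 'rV[R]_2 => r + s * z ord0 i).
Proof.
move=> z; apply: (@continuousD _ R^o _ (fun=> r) (fun z : 'rV[R]_2 => s * z ord0 i)).
  exact: cst_continuous.
apply: (@continuousM _ _ (fun=> s) (fun z : 'rV[R]_2 => z ord0 i)).
  exact: cst_continuous.
exact: coord_continuous.
Qed.

Lemma xparam_continuous : continuous xparam.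
Proof.
rewrite (_ : xparam = fun z => -1 + 3 * z ord0 ord0).
  exact: coord_affine_continuous.
by apply/funext => z; rewrite addrC.
Qed.

Lemma yparam_continuous : continuous yparam.
Proof.
rewrite (_ : yparam = fun z => 2 + (-3) * z ord0 o21).
  exact: coord_affine_continuous.
by apply/funext => z; rewrite mulNr.
Qed.

Lemma clamp_comp_continuous (T : topologicalType) (h : T -> R) :
  continuous h -> continuous (fun s => clamp (h s)).
Proof.
by move=> ch s; apply: continuous_comp; [exact: ch|exact: clamp_continuous].
Qed.

Lemma collar_continuous : continuous collar.
Proof.
have cl i : continuous (fun z : 'rV[R]_2 =>
    clamp (3 * z ord0 i) * clamp (3 - 3 * z ord0 i)).
  move=> z; apply: (@continuousM _ _ (fun z : 'rV[R]_2 => clamp (3 * z ord0 i))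
      (fun z : 'rV[R]_2 => clamp (3 - 3 * z ord0 i)));
    apply: clamp_comp_continuous.
    rewrite (_ : (fun _ => _) = fun z : 'rV[R]_2 => 0 + 3 * z ord0 i).
      exact: coord_affine_continuous.
    by apply/funext => x; rewrite add0r.
  rewrite (_ : (fun _ => _) = fun z : 'rV[R]_2 => 3 + (-3) * z ord0 i).
    exact: coord_affine_continuous.
  by apply/funext => x; rewrite mulNr.
by move=> z; exact: continuousM (cl ord0 z) (cl o21 z).
Qed.

Unset Implicit Arguments.

(** The plane is covered by four closed sets, and on each of them [sphere] is given by a single
    [tri_point] formula. *)
Lemma sphere_continuous : continuous sphere.
Proof.
have cx := clamp_comp_continuous xparam_continuous.
have cy := clamp_comp_continuous yparam_continuous.
have level (h : 'rV[R]_2 -> R) r : continuous h -> closed [set z | h z = r].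
  by move=> ch; apply: (@preimage_closed _ R h [set x | x = r]) => [z _|];
    [exact: ch|exact: closed_eq].
have piece (D : set 'rV[R]_2) (h : 'rV[R]_2 -> E3 G R) : continuous h ->
    (forall z, D z -> sphere z = h z) -> {within D, continuous sphere}.
  by move=> ch hD; apply: (eq_within (fun z Dz => esym (hD z Dz)));
    exact: continuous_subspaceT.
apply/continuous_subspace_setT.
rewrite (_ : [set: 'rV[R]_2] =
  [set z | clamp (xparam z) * clamp (yparam z) = 0] `|`
  ([set z | clamp (xparam z) = 1] `|`
  ([set z | clamp (yparam z) = 1] `|` [set z | collar z = 1]))); last first.
  apply/esym/seteqP; split=> // z _.
  have [x0|x0] := eqVneq (clamp (xparam z)) 0; first by left; rewrite /= x0 mul0r.
  have [y0|y0] := eqVneq (clamp (yparam z)) 0; first by left; rewrite /= y0 mulr0.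
  have [x1|x1] := eqVneq (clamp (xparam z)) 1; first by right; left.
  have [y1|y1] := eqVneq (clamp (yparam z)) 1; first by right; right; left.
  by right; right; right; rewrite /= collar1// clamp_inside.
have cl3 := level _ 0 (fun z => continuousM (cx z) (cy z)).
have cl2 := level _ 1 cx; have cl1 := level _ 1 cy.
have cl0 := level _ 1 collar_continuous.
apply: withinU_continuous => //; first exact/closedU/closedU.
  apply: piece sphere_3; apply: tri_point_continuous.
    exact: collar_continuous.
  exact: yparam_continuous.
apply: withinU_continuous => //; first exact: closedU.
  apply: piece sphere_2; apply: tri_point_continuous.
    exact: collar_continuous.
  exact: yparam_continuous.
apply: withinU_continuous => //.
  apply: piece sphere_1; apply: tri_point_continuous.
    exact: collar_continuous.
  exact: xparam_continuous.
apply: piece sphere_0; apply: tri_point_continuous.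
  exact: yparam_continuous.
exact: xparam_continuous.
Qed.

Set Implicit Arguments.

End Map.

End Sphere.

(** * Homotopies and subdivision *)

Section WithinContinuity.
Context (R : realType).

Lemma within_comp (T T' X : topologicalType) (A : set T) (B : set T')
    (f : T' -> X) (h : T -> T') :
  continuous h -> (forall t, A t -> B (h t)) ->
  {within B, continuous f} -> {within A, continuous (f \o h)}.
Proof.
move=> ch AB /subspace_continuousP cf; apply/subspace_continuousP => t At.
apply: cvg_trans (cf _ (AB _ At)) => U /= /ch.
rewrite /= !nbhs_simpl/= /within/= => tU.
by apply: filterS tU => s hs As; apply: hs; exact: AB.
Qed.

Lemma closedX (T T' : topologicalType) (A : set T) (B : set T') :
  closed A -> closed B -> closed (A `*` B).
Proof.
move=> cA cB; rewrite (_ : A `*` B = fst @^-1` A `&` snd @^-1` B)//.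
apply: closedI; apply: preimage_closed => // z _; [exact: cvg_fst|exact: cvg_snd].
Qed.

Lemma affine_continuous (r s : R) : continuous (fun x : R => r + s * x).
Proof.
move=> x; apply: (@continuousD _ R^o _ (fun=> r) ( *%R s)).
  exact: cst_continuous.
exact: mulrl_continuous.
Qed.

(** The image of the segment is connected, and the trace of [U i] on it is open, and closed since
    the other [U j] cover its complement. *)
Lemma segment_constant (X : topologicalType) (I : Type) (U : I -> set X)
    (gamma : R -> X) i :
  {within `[0, 1], continuous gamma} -> (forall i, open (U i)) ->
  (forall i j x, U i x -> U j x -> i = j) ->
  (forall s, 0 <= s <= 1 -> exists j, U j (gamma s)) ->
  U i (gamma 0) -> U i (gamma 1).
Proof.
move=> cg oU dU exU Ui; pose A := gamma @` [set` `[0, 1]%R].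
have cA : connected A.
  by apply: connected_continuous_connected => //; exact: segment_connected.
have A0 : A (gamma 0) by exists 0 => //=; rewrite in_itv/= lexx ler01.
have A1 : A (gamma 1) by exists 1 => //=; rewrite in_itv/= lexx ler01.
suff AU : A `&` U i = A by rewrite -AU in A1; case: A1.
apply: cA.
- by exists (gamma 0).
- by exists (U i).
- exists (~` \bigcup_(j in [set j | j <> i]) U j).
    by apply: open_closedC; apply: bigcup_open => j _.
  apply/seteqP; split=> x [Ax]; last first.
    move=> nU; split=> //; case: Ax nU => s; rewrite /= in_itv/= => s01 <- nU.
    have [j Uj] := exU s s01; have [<-//|ji] := pselect (j = i).
    by exfalso; apply: nU; exists j.
  by move=> Ux; split=> // -[j ji Uj]; apply: ji; exact: dU Uj Ux.
Qed.

End WithinContinuity.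

(** * Equal homotopy classes come from actual homotopies *)

Section HomotopicEquivalence.
Context (R : realType) (X : topologicalType) (n : nat) (x0 : X).
Implicit Types f g : nloop R n x0.

Let scale_continuous (r s : R) :
  continuous (fun z : 'rV[R]_n * R => (z.1, r + s * z.2)).
Proof.
move=> z; apply: (@cvg_pair _ _ _ (nbhs z) (nbhs z.1) (nbhs (r + s * z.2))).
  exact: cvg_fst.
apply: (@continuous_comp _ _ _ (@snd 'rV[R]_n R) (fun x => r + s * x) z).
  exact: cvg_snd.
exact: affine_continuous.
Qed.

Lemma homotopic_refl f : homotopic f f.
Proof.
exists (f \o fst); split=> // [|t s bt _]; last exact: nloop_boundary.
by apply: (within_comp _ _ (nloop_cts f)) => [z|z []//]; exact: cvg_fst.
Qed.

Lemma homotopic_sym f g : homotopic f g -> homotopic g f.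
Proof.
move=> [H [cH H0 H1 Hb]].
exists (H \o fun z => (z.1, 1 + -1 * z.2)); split.
- apply: (within_comp _ _ cH); first exact: scale_continuous.
  move=> [t s] [/= ct]; rewrite /= !in_itv/= => /andP[s0 s1].
  by split=> //=; rewrite ?in_itv/=; apply/andP; split; lra.
- by move=> t ct /=; rewrite mulr0 addr0 H1.
- by move=> t ct /=; rewrite mulr1 subrr H0.
- by move=> t s bt /andP[s0 s1] /=; apply: Hb => //; apply/andP; split; lra.
Qed.

Lemma homotopic_trans f g h : homotopic f g -> homotopic g h -> homotopic f h.
Proof.
move=> [H [cH H0 H1 Hb]] [K [cK K0 K1 Kb]].
pose L (z : 'rV[R]_n * R) :=
  if z.2 <= 2^-1 then H (z.1, 0 + 2 * z.2) else K (z.1, -1 + 2 * z.2).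
exists L; split.
- rewrite (_ : cube R n `*` _ = (cube R n `*` `[0, 2^-1]) `|`
    (cube R n `*` `[2^-1, 1])); last first.
    apply/seteqP; split=> -[t s] /=.
      rewrite !in_itv/= => -[ct /andP[s0 s1]].
      case: (leP s 2^-1) => [s2|/ltW s2]; [left|right];
        by split=> //; rewrite ?in_itv/=; apply/andP; split; lra.
    by case=> -[ct]; rewrite !in_itv/= => /andP[? ?]; split=> //;
      rewrite ?in_itv/=; apply/andP; split; lra.
  apply: withinU_continuous.
  + by apply: closedX; [exact: closed_cube|exact: itv_closed].
  + by apply: closedX; [exact: closed_cube|exact: itv_closed].
  + apply: (@eq_within _ _ _ (H \o fun z => (z.1, 0 + 2 * z.2))).
      by move=> [t s] [_ /=]; rewrite in_itv/= /L/= => /andP[_ ->].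
    apply: (within_comp _ _ cH); first exact: scale_continuous.
    move=> [t s] [/= ct]; rewrite /= !in_itv/= => /andP[s0 s1].
    by split=> //=; rewrite ?in_itv/=; apply/andP; split; lra.
  + apply: (@eq_within _ _ _ (K \o fun z => (z.1, -1 + 2 * z.2))).
      move=> [t s] [/= ct]; rewrite in_itv/= /L/= => /andP[s0 s1].
      case: ifPn => // s2; have -> : s = 2^-1 by lra.
      have -> : -1 + 2 * 2^-1 = 0 :> R by lra.
      have -> : 0 + 2 * 2^-1 = 1 :> R by lra.
      by rewrite H1// K0.
    apply: (within_comp _ _ cK); first exact: scale_continuous.
    move=> [t s] [/= ct]; rewrite /= !in_itv/= => /andP[s0 s1].
    by split=> //=; rewrite ?in_itv/=; apply/andP; split; lra.
- by move=> t ct; rewrite /L/= invr_ge0 ler0n mulr0 addr0 H0.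
- move=> t ct; rewrite /L/= ifN; last by rewrite -ltNge; lra.
  by rewrite (_ : -1 + 2 * 1 = 1) ?K1//; lra.
- move=> t s bt /andP[s0 s1]; rewrite /L/=; case: ifPn => s2.
    by apply: Hb => //; apply/andP; split; lra.
  by apply: Kb => //; move: s2; rewrite -ltNge => s2; apply/andP; split; lra.
Qed.

Lemma hclass_homotopic f g : hclass f = hclass g -> homotopic f g.
Proof.
have e := @eqmodP {classic nloop R n x0} (equiv_gen_equiv (@homotopic R X n x0)) f g.
move=> /e/asboolP; elim=> [//|h|h k _|h k l _ + _].
- exact: homotopic_refl.
- exact: homotopic_sym.
- exact: homotopic_trans.
Qed.

End HomotopicEquivalence.

(** * Lebesgue numbers and local constancy on the prism *)

Section Prism.
Context (R : realType).
Implicit Types (v w z : 'rV[R]_2 * R) (r : R).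

Definition prism : set ('rV[R]_2 * R) := cube R 2 `*` `[0, 1].

Definition near_box r v z : Prop :=
  (forall i, `|v.1 ord0 i - z.1 ord0 i| <= r) /\ `|v.2 - z.2| <= r.

(** Compactness yields one mesh size valid on the whole domain of a homotopy. *)
Lemma compact_prism : compact prism.
Proof.
apply: compact_setX; last exact: segment_compact.
rewrite (_ : cube R 2 = [set v | forall i, `[0, 1]%classic (v ord0 i)]).
  by apply: (@rV_compact R 2 (fun=> `[0, 1]%classic)) => i; exact: segment_compact.
by apply/seteqP; split=> t /= ct i; have := ct i; rewrite /= in_itv.
Qed.

Lemma near_box_ball r e v z : r < e -> near_box r v z -> ball v e z.
Proof.
move=> re [v1 v2]; split=> /=; last exact: le_lt_trans re.
split=> [|i j]; last by rewrite (ord1 i); exact: le_lt_trans (v1 j) re.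
by apply: le_lt_trans re; exact: le_trans v2.
Qed.

Lemma lebesgue_box (X : topologicalType) (I : Type) (U : I -> set X)
    (h : 'rV[R]_2 * R -> X) :
  {within prism, continuous h} -> (forall i, open (U i)) ->
  (forall x, exists i, U i x) ->
  \forall N \near \oo, forall v, prism v -> exists i, forall z, prism z ->
    near_box N.+1%:R^-1 v z -> U i (h z).
Proof.
move=> /subspace_continuousP ch oU exU.
have /compact_near_coveringP/(_ nat \oo (fun N v => exists i, forall z, prism z ->
    near_box N.+1%:R^-1 v z -> U i (h z)) _) := compact_prism.
apply=> v pv.
have [i Ui] := exU (h v).
have /(ch v pv) : nbhs (h v) (U i) by exact: open_nbhs_nbhs.
rewrite /= /within/= => /nbhs_ballP[e /= e0 vU].
have e2 : 0 < e / 2 by rewrite divr_gt0.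
(* Half of [e] is spent on moving the center from [v] to [w], half on the box around [w]. *)
exists (ball v (e / 2), [set N | N.+1%:R^-1 < e / 2]) => /=.
  split; first exact: nbhsx_ballx.
  exact: near_infty_natSinv_lt (PosNum e2).
move=> [w N] [/= vw Ne]; exists i => z pz wz; apply: vU => //.
exact: ball_split vw (near_box_ball Ne wz).
Qed.

Definition segment v z (s : R) : 'rV[R]_2 * R := v + s *: (z - v).

Lemma segment_continuous v z : continuous (segment v z).
Proof.
move=> s; apply: cvgD; first exact: cvg_cst.
by apply: cvgZr_tmp; exact: cvg_id.
Qed.

Lemma segment_prism v z s : prism v -> prism z -> 0 <= s <= 1 ->
  prism (segment v z s).
Proof.
move=> [v1 v2] [z1 z2] /andP[s0 s1]; split=> /=.
  move=> i; rewrite !mxE; have /andP[? ?] := v1 i; have /andP[? ?] := z1 i.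
  by apply/andP; split; nra.
move: v2 z2; rewrite /= !in_itv/= => /andP[? ?] /andP[? ?].
by apply/andP; split; rewrite /GRing.scale/=; nra.
Qed.

Lemma segment_near_box r w v z s : near_box r w v -> near_box r w z ->
  0 <= s <= 1 -> near_box r w (segment v z s).
Proof.
have conv (a b c : R) : `|a - b| <= r -> `|a - c| <= r -> 0 <= s <= 1 ->
    `|a - (b + s * (c - b))| <= r.
  rewrite !ler_norml => /andP[? ?] /andP[? ?] /andP[? ?].
  by apply/andP; split; nra.
move=> [v1 v2] [z1 z2] s01; split=> [i|]; last exact: conv.
by rewrite !mxE; exact: conv.
Qed.

(** The intersection of two boxes is convex, so the index is constant along the segment from [z] to
    [z']. *)
Lemma box_constant (X : topologicalType) (I : Type) (U : I -> set X)
    (h : 'rV[R]_2 * R -> X) r v w z z' i :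
  {within prism, continuous h} -> (forall i, open (U i)) ->
  (forall i j x, U i x -> U j x -> i = j) ->
  (forall y, prism y -> near_box r v y -> near_box r w y -> exists j, U j (h y)) ->
  prism z -> prism z' -> near_box r v z -> near_box r v z' ->
  near_box r w z -> near_box r w z' -> U i (h z) -> U i (h z').
Proof.
move=> ch oU dU exU pz pz' vz vz' wz wz' Ui.
have e0 : segment z z' 0 = z by rewrite /segment scale0r addr0.
have e1 : segment z z' 1 = z' by rewrite /segment scale1r addrC subrK.
have : U i ((h \o segment z z') 1); last by rewrite /= e1.
apply: (segment_constant (U := U)) => //; last by rewrite /= e0.
  apply: (within_comp _ _ ch); first exact: segment_continuous.
  by move=> s; rewrite /= in_itv/= => s01; exact: segment_prism.
by move=> s s01; apply: exU; [exact: segment_prism|exact: segment_near_box..].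
Qed.

End Prism.

(** * Nullhomotopies *)

Section Grid.
Context (R : realType) (N : nat).
Implicit Types p q : nat * nat * nat.

Definition grid p : 'rV[R]_2 * R :=
  (\row_(i < 2) nth 0 [:: p.1.1%:R / N%:R; p.1.2%:R / N%:R] i, p.2%:R / N%:R).

Lemma grid_prism p : (0 < N)%N -> adj N p p -> prism (grid p).
Proof.
move=> N0 /andP[/and4P[p1 p2 p3 _] _]; have N0' : 0 < N%:R :> R by rewrite ltr0n.
have itv k : (k <= N)%N -> 0 <= (k%:R / N%:R : R) <= 1.
  by move=> kN; rewrite divr_ge0//= ler_pdivrMr// mul1r ler_nat.
split=> /=; last by rewrite in_itv/= itv.
by move=> [[|[|//]] i]; rewrite mxE/= itv.
Qed.

Lemma grid_near_box p q : (0 < N)%N -> adj N p q ->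
  near_box N%:R^-1 (grid p) (grid q).
Proof.
move=> N0 /andP[_ /and5P[p1 q1 p2 q2 /andP[p3 q3]]].
have N0' : 0 < N%:R^-1 :> R by rewrite invr_gt0 ltr0n.
have dist k l : (k <= l.+1)%N -> (l <= k.+1)%N ->
    `|k%:R / N%:R - l%:R / N%:R| <= N%:R^-1 :> R.
  rewrite -!(ler_nat R) -!natr1 => kl lk; rewrite -mulrBl normrM (gtr0_norm N0').
  by rewrite ler_piMl ?(ltW N0')// ler_norml; apply/andP; split; lra.
split=> /=; last exact: dist.
by move=> [[|[|//]] i]; rewrite !mxE/= dist.
Qed.

End Grid.

Section NullHomotopy.
Context (R : realType) (G : groupType) (A : zmodType) (om : G -> G -> G -> A).
Hypothesis alt : alternating3 om.
Hypothesis nil2_flat : forall n (x : {ffun 'I_n.+1 -> G}) i j k l,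
  affinely_nil2 G n x ->
  om ((x i)^-1 * x j)%g ((x i)^-1 * x k)%g ((x i)^-1 * x l)%g = 0.
Hypothesis nil2_triple : forall x : {ffun 'I_3 -> G}, affinely_nil2 G 2 x.
Context (a b c : G).

Notation sph := (@sphere R G nil2_triple a b c).
Notation proj := (class_of (@E3_orbit G R)).

Definition base : B3 G R := proj (@vertex_point R G nil2_triple 1%g).

(** Every label at the vertex 1 is 1 itself. *)
Lemma transition_base F F' g : transition F F' g base -> g = 1%g.
Proof.
move=> /transition_class[h [/label_vertex_point -> /label_vertex_point]].
by rewrite mul1g.
Qed.

Context (H : 'rV[R]_2 * R -> B3 G R).
Hypothesis cH : {within @prism R, continuous H}.
Hypothesis H0 : forall t, cube R 2 t -> H (t, 0) = proj (sph t).
Hypothesis H1 : forall t, cube R 2 t -> H (t, 1) = base.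
Hypothesis Hb : forall t s, cube_boundary R 2 t -> 0 <= s <= 1 ->
  H (t, s) = base.

Section FineGrid.
Context (N : nat) (F : nat * nat * nat -> R -> R).
Context (e : nat * nat * nat -> nat * nat * nat -> G).
Hypothesis N_gt0 : (0 < N)%N.
Hypothesis cF : forall p, cdf (F p).
Hypothesis star : forall p z, adj N p p -> prism z ->
  near_box N%:R^-1 (grid R N p) z -> transition (F p) (F p) 1%g (H z).
Hypothesis eP : forall p q, adj N p q ->
  transition (F p) (F q) (e p q) (H (grid R N p)).

Let adjW p q : adj N p q -> adj N p p /\ adj N q q.
Proof. by rewrite /adj => ?; split; lia. Qed.

Let adjC p q : adj N p q = adj N q p.
Proof. by rewrite /adj; lia. Qed.

(** [F p] and [F q] both have labels on the intersection of their boxes, so the transition read at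
    [p] is also the one at any common neighbour [r]. *)
Let eP' p q r : adj N p q -> adj N p r -> adj N q r ->
  transition (F p) (F q) (e p q) (H (grid R N r)).
Proof.
move=> pq pr qr; have [pp qq] := adjW pq; have [_ rr] := adjW pr.
apply: (@box_constant R _ _ (transition (F p) (F q)) H N%:R^-1 (grid R N p)
  (grid R N q) (grid R N p)).
- exact: cH.
- by move=> g; exact: open_transition.
- by move=> g g' y; exact: transition_unique.
- by move=> y py yp yq; apply: transition_total; exact: star.
- exact: grid_prism.
- exact: grid_prism.
- exact: grid_near_box.
- exact: grid_near_box.
- by apply: grid_near_box => //; rewrite adjC.
- exact: grid_near_box.
- exact: eP.
Qed.

Let cocycle p q r : adj N p q -> adj N q r -> adj N p r ->
  (e p q * e q r)%g = e p r.
Proof.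
move=> pq qr pr; have [pp _] := adjW pq.
apply: (@transition_unique R G (F p) (F r) _ _ (H (grid R N p))) => //.
  apply: (transition_comp _ (eP pq)) => //.
  by apply: eP' => //; rewrite adjC.
exact: eP.
Qed.

Let y i j k : G := potential e N (i, j, k).

Let yE i j k i' j' k' : adj N (i, j, k) (i', j', k') ->
  ((y i j k)^-1 * y i' j' k')%g = e (i, j, k) (i', j', k').
Proof.
move=> pq; rewrite /y -(potentialE cocycle pq) ?mulKg//.
  by move: pq; rewrite /adj/=; lia.
by move: pq; rewrite /adj/=; lia.
Qed.

Let y_base i j k i' j' k' : adj N (i, j, k) (i', j', k') ->
  H (grid R N (i, j, k)) = base -> y i' j' k' = y i j k.
Proof.
move=> pq Hp; have := eP pq; rewrite Hp => /transition_base e1.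
by apply: (mulgI (y i j k)^-1%g); rewrite yE// e1 mulVg.
Qed.

Let H_side i j k : (i <= N)%N -> (j <= N)%N -> (k <= N)%N ->
  [\/ i = 0%N, i = N, j = 0%N | j = N] -> H (grid R N (i, j, k)) = base.
Proof.
move=> iN jN kN ij.
have [ct k01] : prism (grid R N (i, j, k)).
  by apply: grid_prism => //; rewrite /adj/=; lia.
apply: Hb; last by move: k01; rewrite /= in_itv.
have NN : N%:R / N%:R = 1 :> R by rewrite divff// pnatr_eq0 -lt0n.
split=> //; case: ij => ->;
  [exists ord0; left|exists ord0; right|exists ord_max; left|exists ord_max; right];
  by rewrite mxE/= ?mul0r.
Qed.

Let H_top i j : (i <= N)%N -> (j <= N)%N -> H (grid R N (i, j, N)) = base.
Proof.
move=> iN jN; have [ct _] : prism (grid R N (i, j, N)).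
  by apply: grid_prism => //; rewrite /adj/=; lia.
by rewrite /grid/= divff ?H1// pnatr_eq0 -lt0n.
Qed.

(** [H] is constant on the top and on the sides. The labels of each square there agree, so the top
    layer sums to zero, and all layers have the same sum. *)
Let slab0 : slab om N y 0 = 0.
Proof.
rewrite -(@slab_const _ _ _ alt N y _ _ _ N)//.
- rewrite /slab big_nat big1// => i iN; rewrite big_nat big1// => j jN.
  have HN : H (grid R N (i, j, N)) = base by apply: H_top; lia.
  by rewrite !(y_base _ HN) ?quad_const// /adj/=; lia.
- move=> i j k p q r p' q' r' p'' q'' r'' *.
  rewrite !yE; try by rewrite /adj/=; lia.
  apply: (transition_flat (F := F (i, j, k)) nil2_flat); first exact: cF.
  + by apply: eP; rewrite /adj/=; lia.
  + by apply: eP; rewrite /adj/=; lia.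
  + by apply: eP; rewrite /adj/=; lia.
- move=> i j k iN jN kN; have Hi : H (grid R N (i, j, k)) = base.
    by apply: H_side; try lia; case: iN => ->; [constructor 1|constructor 2].
  by rewrite !(y_base _ Hi) ?quad_const// /adj/=; lia.
- move=> i j k iN jN kN; have Hj : H (grid R N (i, j, k)) = base.
    by apply: H_side; try lia; case: jN => ->; [constructor 3|constructor 4].
  by rewrite !(y_base _ Hj) ?quad_const// /adj/=; lia.
Qed.

(** On the bottom face [H] lifts to the sphere in E(3,G), so the potential is the label itself and
    not only its class up to translation. Induction along the diagonal path starts at the corner,
    where the sphere is the vertex 1. *)
Let label_bottom n i j : (n <= N)%N -> (i <= n)%N -> (j <= n)%N ->
  label (F (i, j, 0%N)) (potential e n (i, j, 0%N)) (sph (grid R N (i, j, 0%N)).1).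
Proof.
have lab k l t : adj N (k, l, 0%N) (k, l, 0%N) -> cube R 2 t ->
    near_box N%:R^-1 (grid R N (k, l, 0%N)) (t, 0) ->
    exists g, label (F (k, l, 0%N)) g (sph t).
  move=> pp ct pt; have : prism (t, 0 : R).
    by split=> //=; rewrite in_itv/= lexx ler01.
  move=> /(star pp)/(_ pt); rewrite H0// => /transition_class[g [? _]].
  by exists g.
have z0 : (grid R N (0, 0, 0)%N).2 = 0 by rewrite /= mul0r.
elim: n i j => [|n IH] i j nN.
  rewrite !leqn0 => /eqP -> /eqP -> /=.
  have pp : adj N (0, 0, 0)%N (0, 0, 0)%N by [].
  have [ct _] := grid_prism R N_gt0 pp.
  have [|g lg] := @lab 0%N 0%N (grid R N (0, 0, 0)%N).1 pp ct.
    have := grid_near_box R N_gt0 pp.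
    by rewrite [X in near_box _ _ X]surjective_pairing z0.
  have bd : cube_boundary R 2 (grid R N (0, 0, 0)%N).1.
    by split=> //; exists ord0; left; rewrite mxE/= mul0r.
  by move: lg; rewrite sphere_boundary// => lg; rewrite -{1}(label_vertex_point lg).
move=> iN jN /=; set p := (i, j, 0%N); set q := grid_pred p.
have qE : q = (i.-1, j.-1, 0)%N by [].
have qp : adj N q p by rewrite /adj/=; lia.
have [qq pp] := adjW qp.
have [ctq _] := grid_prism R N_gt0 qq; have [ctp _] := grid_prism R N_gt0 pp.
have lq : label (F q) (potential e n q) (sph (grid R N q).1).
  by rewrite qE; apply: IH; lia.
have g0 k l : (grid R N (k, l, 0%N)).2 = 0 by rewrite /= mul0r.
(* First change the distribution function while staying at [q]; then move from [q] to [p] inside the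
   box of [p], where the label of [F p] is constant. *)
have lp : label (F p) (potential e n q * e q p)%g (sph (grid R N q).1).
  have := eP qp; rewrite [grid R N q]surjective_pairing [(grid R N q).2]g0 H0//.
  move=> /transition_class[h [lh lh']].
  by rewrite (label_unique (cF q) lq lh).
apply: (@box_constant R _ _ (fun g => label (F p) g) (fun z => sph z.1) N%:R^-1
  (grid R N p) (grid R N p) (grid R N q) (grid R N p)) lp.
- apply: continuous_subspaceT => z; apply: continuous_comp; first exact: cvg_fst.
  exact: sphere_continuous.
- by move=> g; exact: open_label.
- by move=> g h x; exact: label_unique.
- move=> z [cz _] [pz _] _; apply: lab => //; split=> //=.
  by rewrite mul0r subrr normr0 invr_ge0.
- exact: grid_prism.
- exact: grid_prism.
- by apply: grid_near_box => //; rewrite adjC.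
- exact: grid_near_box.
- by apply: grid_near_box => //; rewrite adjC.
- exact: grid_near_box.
Qed.

(** With [N] divisible by 3 the middle ninth is bounded by grid lines, and the bottom layer is
    subject to both [sperner] and [slab0]. *)
Lemma fine_grid_om0 M : N = (3 * M)%N -> om a b c = 0.
Proof.
move=> NM; have M_gt0 : (0 < M)%N by lia.
rewrite -slab0 /slab NM.
rewrite -(@sperner _ _ _ alt a b c M (fun i j => y i j 0))// => i j iM jM.
have coordE k : 3 * (k%:R / N%:R) = k%:R / M%:R :> R.
  have M0 : M%:R != 0 :> R by rewrite pnatr_eq0 -lt0n.
  by rewrite NM natrM invfM mulrCA mulrA mulrA mulfK ?mulrA ?mulVf ?mul1r// pnatr_eq0.
have M0' : 0 < M%:R :> R by rewrite ltr0n.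
have xE : xparam (grid R N (i, j, 0%N)).1 = i%:R / M%:R - 1.
  by rewrite /xparam mxE/= coordE.
have yE' : yparam (grid R N (i, j, 0%N)).1 = 2 - j%:R / M%:R.
  by rewrite /yparam mxE/= coordE.
have le1 k : (k <= M)%N -> k%:R / M%:R <= 1 :> R.
  by move=> kM; rewrite ler_pdivrMr// mul1r ler_nat.
have ge1 k : (M <= k)%N -> 1 <= k%:R / M%:R :> R.
  by move=> kM; rewrite ler_pdivlMr// mul1r ler_nat.
have le2 k : (k <= 2 * M)%N -> k%:R / M%:R <= 2 :> R.
  by move=> kM; rewrite ler_pdivrMr// -natrM ler_nat.
have ge2 k : (2 * M <= k)%N -> 2 <= k%:R / M%:R :> R.
  by move=> kM; rewrite ler_pdivlMr// -natrM ler_nat.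
have := @label_bottom N i j (leqnn _); rewrite {1 2}NM => /(_ iM jM).
move=> /label_sphere; rewrite -/(y i j 0) xE yE'.
have x1 : clamp (i%:R / M%:R - 1 : R) != 1 -> (i < 2 * M)%N.
  by apply: contraR; rewrite -leqNgt => /ge2 ?; rewrite clamp1//; lra.
have x0 : clamp (i%:R / M%:R - 1 : R) != 0 -> (M < i)%N.
  by apply: contraR; rewrite -leqNgt => /le1 ?; rewrite clamp0//; lra.
have y0 : clamp (2 - j%:R / M%:R : R) != 0 -> (j < 2 * M)%N.
  by apply: contraR; rewrite -leqNgt => /ge2 ?; rewrite clamp0//; lra.
have y1 : clamp (2 - j%:R / M%:R : R) != 1 -> (M < j)%N.
  by apply: contraR; rewrite -leqNgt => /le1 ?; rewrite clamp1//; lra.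
case=> [[-> nc]|[-> [/x1 ? /y0 ?]]|[-> [/x0 ? /y0 ?]]|[-> /y1 ?]].
(* On the middle ninth [collar] is 1, which excludes the apex label. *)
- constructor 1; split=> // -[/andP[/ge1 i1 /le2 i2] /andP[/ge1 j1 /le2 j2]].
  by move/negP: nc; apply; rewrite collar1// ?xE ?yE'; apply/andP; split; lra.
- by constructor 2.
- by constructor 3.
- by constructor 4.
Qed.

End FineGrid.

Lemma nullhomotopic_om0 : om a b c = 0.
Proof.
(* The cover consists of the sets over which a given distribution function has a label. *)
pose U (F : {F : R -> R | cdf F}) := transition (sval F) (sval F) (1 : G)%g.
have [|x|N0 _ leb] := @lebesgue_box R _ _ U H cH.
- by move=> [F cF]; exact: open_transition.
- by have [F [cF Fx]] := transition_exists x; exists (exist _ F cF).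
pose N := (3 * N0.+1)%N; have N_gt0 : (0 < N)%N by [].
have [F star] : {F : nat * nat * nat -> {F : R -> R | cdf F} &
    forall p z, adj N p p -> prism z ->
      near_box N%:R^-1 (grid R N p) z -> U (F p) (H z)}.
  apply: (@choice _ _ (fun p F => forall z, adj N p p -> prism z ->
      near_box N%:R^-1 (grid R N p) z -> U F (H z))) => p.
  have [pp|npp] := boolP (adj N p p); last first.
    (* Outside the grid any distribution function will do. *)
    by have [F [cF _]] := transition_exists base; exists (exist _ F cF).
  have N1 : (N0 <= N.-1)%N by rewrite /N; lia.
  have [F FP] := leb _ N1 _ (grid_prism R N_gt0 pp).
  by exists F => z _ pz pz'; apply: FP; rewrite // prednK.
have [e eP] : {e : (nat * nat * nat) * (nat * nat * nat) -> G &
    forall pq, adj N pq.1 pq.2 ->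
      transition (sval (F pq.1)) (sval (F pq.2)) (e pq) (H (grid R N pq.1))}.
  apply: (@choice _ _ (fun pq g => adj N pq.1 pq.2 -> transition (sval (F pq.1))
      (sval (F pq.2)) g (H (grid R N pq.1)))) => -[p q] /=.
  have [pq|npq] := boolP (adj N p q); last by exists 1%g.
  have pp : adj N p p by move: pq; rewrite /adj; lia.
  have qq : adj N q q by move: pq; rewrite /adj; lia.
  have qp : adj N q p by move: pq; rewrite /adj; lia.
  have pg := grid_prism R N_gt0 pp.
  have [g eg] := transition_total (star p _ pp pg (grid_near_box R N_gt0 pp))
    (star q _ qq pg (grid_near_box R N_gt0 qp)).
  by exists g.
apply: (@fine_grid_om0 N (fun p => sval (F p)) (fun p q => e (p, q))
  _ _ _ _ N0.+1) => //.
- by move=> p; case: (F p).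
- by move=> p q pq; exact: (eP (p, q)).
Qed.

End NullHomotopy.

(** * Nontriviality of the second homotopy group *)

Section Main.
Context (R : realType) (G : groupType).
Hypothesis engel : two_engel G.
Hypothesis class3 : nilpotency_class 3 [set: G].

(** The sphere on a tetrahedron with [comm3 a b c != 0] is compared with the constant loop; a
    homotopy between them would force [comm3 a b c = 0]. *)
Lemma B3_pi2_nontrivial : exists (x0 : B3 G R) (u v : homotopy_group R 2 x0), u <> v.
Proof.
have [a [b [c abc]]] := comm3_proper class3.
have triple := affinely_nil2_triple engel class3.
pose x0 : B3 G R := base R triple.
have fb t : cube_boundary R 2 t ->
    class_of (@E3_orbit G R) (@sphere R G triple a b c t) = x0.
  by move=> bt; rewrite sphere_boundary.
have cf : {within cube R 2, continuous
    (fun t => class_of (@E3_orbit G R) (@sphere R G triple a b c t))}.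
  apply: continuous_subspaceT => t; apply: continuous_comp.
    exact: sphere_continuous.
  exact: class_of_continuous.
have cc : {within cube R 2, continuous (fun=> x0)}.
  by apply: continuous_subspaceT => t; exact: cst_continuous.
pose f := NLoop cf fb; pose k := @NLoop R _ 2 x0 _ cc (fun _ _ => erefl).
exists x0, (hclass f), (hclass k) => /hclass_homotopic[H [cH H0 H1 Hb]].
move/eqP: abc; apply.
apply: (nullhomotopic_om0 (comm3_alternating engel class3) _ cH H0 H1 Hb).
by move=> n x i j l m; exact: affinely_nil2_comm3.
Qed.

End Main.

Theorem corollary2p11 (R : realType) (G : groupType)
  (hEngel : two_engel G) (hclass3 : nilpotency_class 3 [set: G])
  (P : groupType) :
  ~ eilenberg_maclane1 R (B3 G R) P.
Proof.
have [x0 [u [v uv]]] := B3_pi2_nontrivial R hEngel hclass3.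
by move=> [_ /(_ x0)[_ /(_ 2%N isT u v)]].
Qed.
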